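(* Let $T:(0,1]\to(0,1]$ be defined by $Tx=2^n x-1$ for $x\in(2^{-n},2^{-n+1}]$, $n\in\mathbb{N}=\{1,2,\dots\}$. For $x\in(0,1]$ let $d_1(x)=\lceil -\log_2 x\rceil$ and $d_i(x)=d_1(T^{i-1}x)$ for $i\ge 2$, so that $x=\sum_{i\ge1}2^{-(d_1(x)+\cdots+d_i(x))}$. Define the Khintchine exponent $\gamma(x)=\lim_{n\to\infty}\frac1n\sum_{j=1}^n d_j(x)$ (when the limit exists) and, for $\xi\ge 1$, $E(\xi)=\{x\in(0,1]:\gamma(x)=\xi\}$ and $t(\xi)=\dim_H E(\xi)$. Then $\dim_H E(1)=0$ and for every $\xi>1$, $$t(\xi)=\dim_H E(\xi)=\frac{\frac{\log(\xi-1)}{\xi}+\log\xi-\log(\xi-1)}{\log 2}.$$ Moreover: (1) $t(2)=1$; (2) $\lim_{\xi\to1}t(\xi)=0$ and $\lim_{\xi\to\infty}t(\xi)=0$; (3) $t'(\xi)>0$ for $1<\xi<2$, $t'(2)=0$, and $t'(\xi)<0$ for $\xi>2$; (4) $\lim_{\xi\to1}t'(\xi)=\infty$ and $\lim_{\xi\to\infty}t'(\xi)=0$; (5) the function $t$ has exactly one inflection point on $(1,\infty)$.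
   Context: $\dim_H$ denotes Hausdorff dimension, with $\dim_H\emptyset=0$.
   Formalization: The digit d_1(x) is taken to be the n with x in (2^{-n},2^{-n+1}], i.e. floor(-log_2 x)+1, instead of ceil(-log_2 x), which at dyadic points such as x=1 gives 0 and contradicts T and the stated expansion; only countably many x are affected. *)

(* Defs.v *)
From HB Require Import structures.
From mathcomp Require Import all_boot all_order all_algebra.
From mathcomp Require Import all_classical all_reals all_analysis.
Set Implicit Arguments. Unset Strict Implicit. Unset Printing Implicit Defensive.
Import Order.TTheory GRing.Theory Num.Theory.
Import numFieldNormedType.Exports.
Local Open Scope classical_set_scope.
Local Open Scope ring_scope.

Section Hausdorff.
Variable R : realType.

(* diameter of a subset of R (sup of empty set is -oo; only used for nonempty sets
   in the cost, and as an upper bound constraint, which is harmless for set0) *)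
Definition diam (A : set R) : \bar R :=
  ereal_sup [set (`|p.1 - p.2|)%:E | p in A `*` A].

Definition hcost (s : R) (U : set R) : \bar R :=
  if `[< U = set0 >] then 0%E
  else match diam U with
       | EFin r => (r `^ s)%:E
       | _ => +oo%E
       end.

Definition hausdorff_delta (s delta : R) (E : set R) : \bar R :=
  ereal_inf [set (\sum_(0 <= i <oo) hcost s (U i))%E
            | U in [set U : nat -> set R |
                    E `<=` \bigcup_i U i /\ forall i, (diam (U i) <= delta%:E)%E]].

Definition hausdorff_measure (s : R) (E : set R) : \bar R :=
  ereal_sup [set hausdorff_delta s delta E | delta in [set delta : R | 0 < delta]].

(* Hausdorff dimension: inf { s >= 0 | H^s(E) = 0 }  (dim_H set0 = 0) *)
Definition hdim (E : set R) : \bar R :=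
  ereal_inf [set s%:E | s in [set s : R | 0 <= s /\ hausdorff_measure s E = 0%E]].

(* d_1(x) = n  for x in (2^-n, 2^-n+1], i.e. floor(-log2 x) + 1 *)
Definition d1 (x : R) : int := Num.floor (- ln x / ln 2) + 1.

Definition Tmap (x : R) : R := 2 `^ (d1 x)%:~R * x - 1.

(* d_i(x) = d_1(T^{i-1} x);  digit j (0-based) is d_{j+1} *)
Definition digit (j : nat) (x : R) : int := d1 (iter j Tmap x).

Definition avg_digits (x : R) (n : nat) : R :=
  (n%:R)^-1 * \sum_(j < n) (digit j x)%:~R.

Definition Eset (xi : R) : set R :=
  [set x | 0 < x <= 1 /\ (avg_digits x @ \oo --> xi)].

(* t(xi) = dim_H E(xi)  (a real number; dim_H of a subset of R is in [0,1]) *)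
Definition tdim (xi : R) : R := fine (hdim (Eset xi)).

Definition convex_on (f : R -> R) (A : set R) : Prop :=
  forall x y l : R, A x -> A y -> 0 <= l <= 1 ->
    f (l * x + (1 - l) * y) <= l * f x + (1 - l) * f y.

Definition concave_on (f : R -> R) (A : set R) : Prop :=
  convex_on (fun x => - f x) A.

Definition inflection_point (f : R -> R) (c : R) : Prop :=
  exists2 d : R, 0 < d &
    (convex_on f [set x | c - d <= x <= c] /\ concave_on f [set x | c <= x <= c + d])
    \/ (concave_on f [set x | c - d <= x <= c] /\ convex_on f [set x | c <= x <= c + d]).

End Hausdorff.

(* Main.v *)
(* The digit d_j is a gap between consecutive ones in the binary expansion, so a digit word w
   corresponds to the dyadic interval [cyl w (0, 1]], of length 2^-(sum w).
   Upper bound: a point of E(xi) lies, for all large n, in an interval [cyl w (0, 1]] with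
   |w| = n and |sum w - n xi| <= n eps.  The weights e^(-a sum w) (a > 0) add up to
   (e^a - 1)^-n over the words of length n, so the b/ln 2 - costs of those intervals are
   dominated by a geometric series as soon as (a - b) xi < ln (e^a - 1); the best choice is
   e^a = xi / (xi - 1), and a tends to infinity when xi = 1.
   Lower bound: fix a large block length n and concatenate compositions of n whose numbers of
   parts follow a Beatty sequence of slope n / xi; the resulting points lie in E(xi).  Each
   block can be chosen in at least M >= 2^(ns) ways, where s is any number below the entropy
   bound, so the base-M digits of y in [0, 1) index such points.  A set of diameter at most
   2^-(nk) meets at most 3 of the level-k intervals, hence pulls back to a set of
   Lebesgue measure at most 3 M^-k, and a cover of E(xi) cannot have small s-cost. *)
Require Import Defs.
From HB Require Import structures.
From mathcomp Require Import all_boot all_order all_algebra.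
From mathcomp Require Import all_classical all_reals all_analysis.
From mathcomp Require Import ring lra zify.
Set Implicit Arguments. Unset Strict Implicit. Unset Printing Implicit Defensive.
Import Order.TTheory GRing.Theory Num.Theory.
Import numFieldNormedType.Exports.
Local Open Scope classical_set_scope.
Local Open Scope ring_scope.

(** * Digit words and dyadic intervals *)

(** The interval of [w] starts at [bval w / 2 ^ sumn w]. With the numerator kept in [nat], equality
    and adjacency of intervals of the same length become integer arithmetic. *)
Fixpoint bval (w : seq nat) : nat :=
  if w is _ :: w' then (2 ^ sumn w' + bval w')%N else 0%N.

Definition cyl {R : realType} (w : seq nat) (x : R) : R :=
  ((bval w)%:R + x) / 2 ^+ sumn w.

Section Dynamics.
Context {R : realType}.
Implicit Types (x : R) (w : seq nat).

(** The map x -> (1 + x) / 2^d is the inverse branch of [Tmap] with digit d, so [cyl w] is a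
    composition of inverse branches. *)
Lemma cyl_cons d w x : cyl (d :: w) x = (1 + cyl w x) / 2 ^+ d.
Proof.
rewrite /cyl /= natrD natrX exprD.
have h1 : (2 : R) ^+ d != 0 by rewrite expf_neq0 // pnatr_eq0.
have h2 : (2 : R) ^+ sumn w != 0 by rewrite expf_neq0 // pnatr_eq0.
by field; rewrite h1 h2.
Qed.

Lemma bval_lt w : all (leq 1) w -> (bval w < 2 ^ sumn w)%N.
Proof.
elim: w => //= d w IH /andP[d0 /IH h].
rewrite expnD; apply: (@leq_trans (2 ^ sumn w + 2 ^ sumn w)).
  by rewrite -addnS leq_add2l.
rewrite addnn -mul2n leq_mul2r; apply/orP; right.
by rewrite -{1}(expn1 2) leq_exp2l.
Qed.

Lemma cyl_itv w x : all (leq 1) w -> 0 < x <= 1 -> 0 < cyl w x <= 1.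
Proof.
move=> /bval_lt h /andP[x0 x1]; rewrite /cyl.
have h2 : (0 : R) < 2 ^+ sumn w by rewrite exprn_gt0.
rewrite divr_gt0 //= ?ltr_wpDl //.
rewrite ler_pdivrMr // mul1r -natrX.
apply: (@le_trans _ _ (bval w).+1%:R); last by rewrite ler_nat.
by rewrite -(addn1 (bval w)) natrD lerD2l.
Qed.

Lemma ln_pow2 (d : nat) : ln (2 ^+ d) = d%:R * ln 2 :> R.
Proof. by rewrite (lnXn d (ltr0Sn R 1)) mulr_natl. Qed.

(** Here -log2 of the argument is d - log2 (1 + x) with log2 (1 + x) in (0, 1], so the floor in [d1]
    equals d - 1, also at x = 1. *)
Lemma d1_branch (d : nat) x : 0 < x <= 1 -> d1 ((1 + x) / 2 ^+ d) = d%:Z.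
Proof.
move=> /andP[x0 x1].
have l2 : 0 < ln (2 : R) by rewrite ln_gt0 // ltr1n.
have p2 : (0 : R) < 2 ^+ d by rewrite exprn_gt0.
have e : - ln ((1 + x) / 2 ^+ d) / ln 2 = d%:R - ln (1 + x) / ln 2.
  rewrite ln_div ?posrE //; last lra.
  rewrite ln_pow2 opprB mulrBl mulfK ?gt_eqF //.
rewrite /d1 e.
have -> : d%:R - ln (1 + x) / ln 2 = (1 - ln (1 + x) / ln 2) + (d%:Z - 1)%:~R.
  by rewrite intrD /= intrN /=; ring.
rewrite floorDrz ?rpred_int //; last first.
rewrite intrKfloor.
suff -> : Num.floor (1 - ln (1 + x) / ln 2) = 0 by rewrite add0r subrK.
apply: floor_def; rewrite add0r.
have l1 : 0 < ln (1 + x) by rewrite ln_gt0 //; lra.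
have l3 : ln (1 + x) <= ln 2 by rewrite ler_ln ?posrE //; lra.
have a : 0 < ln (1 + x) / ln 2 by rewrite divr_gt0.
have b : ln (1 + x) / ln 2 <= 1 by rewrite ler_pdivrMr // mul1r.
by rewrite subr_ge0 b /=; lra.
Qed.

Lemma Tmap_branch (d : nat) x : 0 < x <= 1 -> Tmap ((1 + x) / 2 ^+ d) = x.
Proof.
move=> hx; rewrite /Tmap d1_branch // powR_mulrn ?ler0n //.
rewrite mulrC divfK ?expf_neq0 ?pnatr_eq0 //; ring.
Qed.

(** With d = [d1 x], the two bounds on the floor of -log2 x say exactly that 1 < 2^d x <= 2. *)
Lemma branch_exists x : 0 < x <= 1 ->
  exists d : nat, [/\ (0 < d)%N, d1 x = d%:Z, 0 < Tmap x <= 1 & x = (1 + Tmap x) / 2 ^+ d].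
Proof.
move=> /andP[x0 x1].
have l2 : 0 < ln (2 : R) by rewrite ln_gt0 // ltr1n.
have l0 : 0 <= - ln x / ln 2 by rewrite divr_ge0 ?(ltW l2) // oppr_ge0 ln_le0.
have f0 : 0 <= Num.floor (- ln x / ln 2) by rewrite floor_ge0.
exists (absz (Num.floor (- ln x / ln 2))).+1.
have e : d1 x = (absz (Num.floor (- ln x / ln 2))).+1%:Z.
  by rewrite /d1 intS gez0_abs // addrC.
set d := (absz _).+1 in e *.
have p2 : (0 : R) < 2 ^+ d by rewrite exprn_gt0.
have eT : Tmap x = 2 ^+ d * x - 1 by rewrite /Tmap e powR_mulrn ?ler0n.
have /andP[fl1 fl2] := floor_itv (- ln x / ln 2).
have e1 : (Num.floor (- ln x / ln 2) + 1)%:~R = d%:R :> R.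
  by move: e; rewrite /d1 => ->.
move: fl1 fl2; rewrite e1 => fl1 fl2.
have {}e1 : (Num.floor (- ln x / ln 2))%:~R = d%:R - 1 :> R.
  by rewrite -e1 intrD /=; ring.
move: fl1; rewrite e1 ler_pdivlMr // => fl1.
move: fl2; rewrite ltr_pdivrMr // => fl2.
have lnp : ln (2 ^+ d * x) = d%:R * ln 2 + ln x.
  by rewrite lnM ?posrE // ln_pow2.
have px : 0 < 2 ^+ d * x by rewrite mulr_gt0.
split => //.
- rewrite eT; apply/andP; split.
  + by rewrite subr_gt0 -ltr_ln ?posrE // ln1 lnp addrC -ltrBlDl sub0r.
  + rewrite lerBlDr -ler_ln ?posrE // lnp -[1 + 1]/2 addrC -lerBrDl -subr_ge0.
    by move: fl1; rewrite -subr_ge0; congr (is_true (0 <= _)); ring.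
- by rewrite eT addrC subrK mulrAC divff ?mul1r // gt_eqF.
Qed.

Lemma iter_Tmap_itv n x : 0 < x <= 1 -> 0 < iter n (@Tmap R) x <= 1.
Proof.
by move=> hx; elim: n => //= n IH; have [d []] := branch_exists IH.
Qed.

Lemma digit_cyl w x j : all (leq 1) w -> 0 < x <= 1 -> (j < size w)%N ->
  digit j (cyl w x) = (nth 0%N w j)%:Z.
Proof.
elim: w j => //= d w IH j /andP[d0 aw] hx.
have hc := cyl_itv aw hx.
rewrite cyl_cons; case: j => [|j] hj; first by rewrite /digit /= d1_branch.
by rewrite /digit iterSr Tmap_branch // -/(digit _ _) IH.
Qed.

Lemma digits_cyl n x : 0 < x <= 1 ->
  exists w : seq nat, [/\ size w = n, all (leq 1) w,
    (sumn w)%:R = \sum_(j < n) (digit j x)%:~R :> R & x = cyl w (iter n (@Tmap R) x)].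
Proof.
elim: n x => [|n IH] x hx.
  by exists [::]; rewrite big_ord0 /cyl /= add0r divr1.
have [d [d0 ed hT ex]] := branch_exists hx.
have [w [sw aw sumw ew]] := IH _ hT.
exists (d :: w); split => //=; first by rewrite sw.
- by rewrite d0.
- rewrite natrD sumw big_ord_recl /digit /= ed; congr (_ + _).
  by apply: eq_bigr => i _; rewrite -iterS iterSr.
- by rewrite cyl_cons -iterS iterSr -ew.
Qed.

(** For a nonempty word with tail v, 2^(sumn v) <= [bval] < 2^(sumn v + 1). The leading bit thus
    recovers the sum of the tail, and the total sum then gives the head. *)
Lemma bval_inj w w' : all (leq 1) w -> all (leq 1) w' -> sumn w = sumn w' ->
  bval w = bval w' -> w = w'.
Proof.
elim: w w' => [|d w IH] [|d' w'] //=.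
- by move=> _ _ _ /esym/eqP; rewrite addn_eq0 expn_eq0.
- by move=> _ _ _ /eqP; rewrite addn_eq0 expn_eq0.
move=> /andP[d0 aw] /andP[d0' aw'] es eb.
have hw := bval_lt aw; have hw' := bval_lt aw'.
suff ee : sumn w = sumn w'.
  have -> : d = d' by move: es; rewrite ee => /eqP; rewrite eqn_add2r => /eqP.
  by rewrite (IH w') //; move: eb; rewrite ee => /eqP; rewrite eqn_add2l => /eqP.
have key a b u v : (u < 2 ^ a)%N -> (2 ^ a + u = 2 ^ b + v)%N -> (b <= a)%N.
  move=> ha e; rewrite leqNgt; apply/negP => ab.
  have : (2 ^ a.+1 <= 2 ^ b)%N by rewrite leq_exp2l.
  rewrite expnS; lia.
apply/eqP; rewrite eqn_leq; apply/andP; split.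
  by apply: (key _ _ _ _ hw' (esym eb)).
by apply: (key _ _ _ _ hw eb).
Qed.

End Dynamics.

(** * Covering E(xi): the upper bound *)

Section HausdorffFacts.
Context {R : realType}.
Implicit Types (s r : R) (U E : set R).

Lemma le_nneseries_partial (u : nat -> \bar R) (x : \bar R) :
  (forall n, 0 <= u n)%E -> (forall N, \sum_(0 <= i < N) u i <= x)%E ->
  (\sum_(0 <= i <oo) u i <= x)%E.
Proof.
by move=> u0 ux; apply: lime_le; [exact: is_cvg_nneseries|exact: nearW].
Qed.

Lemma hcost_ge0 s U : (0 <= hcost s U)%E.
Proof.
by rewrite /hcost; case: ifP => // _; case: (diam U) => // r; rewrite lee_fin powR_ge0.
Qed.

Lemma diam_ge0 U : U !=set0 -> (0 <= diam U)%E.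
Proof.
move=> [x Ux]; apply: ereal_sup_ubound; exists (x, x) => //=.
by rewrite subrr normr0.
Qed.

Lemma diam_le U r : (forall x y, U x -> U y -> `|x - y| <= r) -> (diam U <= r%:E)%E.
Proof.
by move=> h; apply: ge_ereal_sup => _ [[x y] [/= Ux Uy] <-]; rewrite lee_fin h.
Qed.

Lemma le_diam U r : (diam U <= r%:E)%E -> forall x y, U x -> U y -> `|x - y| <= r.
Proof.
move=> h x y Ux Uy; rewrite -lee_fin; apply: le_trans h.
by apply: ereal_sup_ubound; exists (x, y).
Qed.

Lemma hcost_le s U r : 0 <= s -> (forall x y, U x -> U y -> `|x - y| <= r) ->
  (hcost s U <= (r `^ s)%:E)%E.
Proof.
move=> s0 h; have [U0|/set0P Un] := eqVneq U set0.
  by rewrite /hcost; case: asboolP => // _; rewrite lee_fin powR_ge0.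
have := diam_le h; have := diam_ge0 Un.
rewrite /hcost; case: asboolP => [U0|_]; first by move: Un; rewrite U0 => -[].
case: (diam U) => // d; rewrite !lee_fin => d0 dr.
by rewrite ge0_ler_powR // ?nnegrE // (le_trans d0).
Qed.

Lemma hcost_set0 s : hcost s (set0 : set R) = 0%E.
Proof. by rewrite /hcost; case: asboolP. Qed.

Lemma hausdorff_measure_null s E :
  (forall delta e : R, 0 < delta -> 0 < e -> exists U : nat -> set R,
    [/\ E `<=` \bigcup_i U i, forall i, (diam (U i) <= delta%:E)%E &
        (\sum_(0 <= i <oo) hcost s (U i) <= e%:E)%E]) ->
  hausdorff_measure s E = 0%E.
Proof.
move=> h; apply/eqP; rewrite eq_le; apply/andP; split.
- apply: ge_ereal_sup => _ [delta /= d0 <-].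
  apply/lee_addgt0Pr => e e0; rewrite add0e.
  have [U [EU dU sU]] := h _ _ d0 e0; apply: le_trans sU.
  by apply: ereal_inf_lbound; exists U.
- apply: (@le_trans _ _ (hausdorff_delta s 1 E)).
    apply: le_ereal_inf_tmp => _ [U _ <-]; apply: nneseries_ge0 => *; exact: hcost_ge0.
  by apply: ereal_sup_ubound; exists 1 => //=.
Qed.

Lemma nneseries_nat2 (a : nat * nat -> \bar R) : (forall k, 0 <= a k)%E ->
  exists2 f : nat -> nat * nat, (forall p, exists i, f i = p) &
  (\sum_(0 <= i <oo) a (f i) = \sum_(0 <= n <oo) \sum_(0 <= k <oo) a (n, k))%E.
Proof.
move=> a0; have /card_esym/ppcard_eqP[f] := card_nat2.
exists f => [p|]; first by exists (f^-1%FUN p); rewrite invK ?inE.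
rewrite -(esum_pred_image a _ xpredT) ?[fun=> _]set_true //.
rewrite image_eq nneseries_esumT; last by move=> n; exact: nneseries_ge0.
rewrite (@eq_esum _ _ _ _ (fun n => \esum_(k in setT) a (n, k))%E); last first.
  by move=> n _; rewrite nneseries_esumT.
rewrite (@esum_esum R _ _ setT (fun=> setT) (fun n k => a (n, k))) //; congr esum; last by apply/funext => -[].
by apply/seteqP; split => -[].
Qed.

(** Covers by the words of every large length form a sequence of finite families; an enumeration of
    pairs of naturals turns them into the single sequence that the Hausdorff measure asks for. *)
Lemma hausdorff_measure_null2 s E :
  (forall delta e : R, 0 < delta -> 0 < e -> exists U : nat -> nat -> set R,
    [/\ E `<=` \bigcup_n \bigcup_k U n k, forall n k, (diam (U n k) <= delta%:E)%E &
        (\sum_(0 <= n <oo) \sum_(0 <= k <oo) hcost s (U n k) <= e%:E)%E]) ->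
  hausdorff_measure s E = 0%E.
Proof.
move=> h; apply: hausdorff_measure_null => delta e d0 e0.
have [U [EU dU sU]] := h _ _ d0 e0.
have [f fsurj fsum] := @nneseries_nat2 (fun p => hcost s (U p.1 p.2)) (fun=> hcost_ge0 _ _).
exists (fun i => U (f i).1 (f i).2); split => //; last by rewrite fsum.
move=> x /EU[n _ [k _ Ux]]; have [i fi] := fsurj (n, k).
by exists i => //; rewrite fi.
Qed.

End HausdorffFacts.

(** Letters are cut off at B to have finite lists. No word of sum at most B is lost, since its
    letters are positive and at most B. *)
Fixpoint words (n B : nat) : seq (seq nat) :=
  if n is n'.+1 then [seq d :: w | d <- iota 1 B, w <- words n' B] else [:: [::]].

Lemma mem_words n B w : size w = n -> all (leq 1) w -> (sumn w <= B)%N -> w \in words n B.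
Proof.
elim: n w => [|n IH] [|d w] //= [sw] /andP[d0 aw] hs.
apply/allpairsP; exists (d, w); split => //=.
  by rewrite mem_iota d0 add1n ltnS (leq_trans _ hs) // leq_addr.
by apply: IH => //; rewrite (leq_trans _ hs) // leq_addl.
Qed.

Lemma words_size n B w : w \in words n B -> size w = n /\ all (leq 1) w.
Proof.
elim: n w => [|n IH] w /=; first by rewrite inE => /eqP ->.
move=> /allpairsP[[d v] /= [hd /IH[sv av] ->]] /=.
by rewrite sv av; move: hd; rewrite mem_iota => /andP[-> _].
Qed.

Lemma leq_size_sumn w : all (leq 1) w -> (size w <= sumn w)%N.
Proof. by elim: w => //= d w IH /andP[d0 /IH h]; rewrite -add1n leq_add. Qed.

Section Upper.
Context {R : realType}.

(** The sum factors over the letters into the n-th power of a truncated geometric series x + ... +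
    x^B. For x = e^(-a) the bound is (e^a - 1)^(-n). *)
Lemma sum_words (x : R) n B : 0 <= x < 1 ->
  \sum_(w <- words n B) x ^+ sumn w <= (x / (1 - x)) ^+ n.
Proof.
move=> /andP[x0 x1]; elim: n => [|n IH] /=; first by rewrite big_seq1 expr0.
rewrite big_allpairs_dep /=.
under eq_bigr => d _.
  under eq_bigr => w _ do rewrite exprD.
  rewrite -mulr_sumr; over.
rewrite -mulr_suml exprS ler_pM //.
- by apply: sumr_ge0 => *; rewrite exprn_ge0.
- by apply: sumr_ge0 => *; rewrite exprn_ge0.
- rewrite ler_pdivlMr ?subr_gt0 //.
  have -> : (\sum_(d <- iota 1 B) x ^+ d) * (1 - x) = x - x ^+ B.+1.
    elim: B {IH} => [|B IH]; first by rewrite big_nil mul0r expr1 subrr.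
    by rewrite -[B.+1]addn1 iotaD big_cat big_seq1 mulrDl IH addn1 add1n !exprS; ring.
  by rewrite gerBl exprn_ge0.
Qed.

Lemma avg_digits_cyl (x : R) n : 0 < x <= 1 -> (0 < n)%N ->
  exists w, [/\ size w = n, all (leq 1) w, (sumn w)%:R = n%:R * avg_digits x n
    & exists2 y, 0 < y <= 1 & x = cyl w y].
Proof.
move=> hx n0; have [w [sw aw sumw xw]] := digits_cyl n hx.
exists w; split => //.
  by rewrite /avg_digits mulrA divff ?mul1r // pnatr_eq0 -lt0n.
by exists (iter n (@Tmap R) x) => //; exact: iter_Tmap_itv.
Qed.

Definition cylset (w : seq nat) : set R := [set cyl w y | y in [set y : R | 0 < y <= 1]].

Lemma diam_cylset w x y : cylset w x -> cylset w y -> `|x - y| <= (2 ^+ sumn w)^-1.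
Proof.
move=> [a /= /andP[a0 a1] <-] [b /= /andP[b0 b1] <-].
rewrite /cyl -mulrBl normrM [X in _ * X]gtr0_norm ?invr_gt0 ?exprn_gt0 //.
rewrite ler_piMl ?invr_ge0 ?exprn_ge0 // ler_norml; lra.
Qed.

(** A finite family becomes a sequence by padding with empty sets, which cost nothing. *)
Lemma nneseries_nth_le (F : set R -> \bar R) (L : seq (set R)) : F set0 = 0%E ->
  (forall U, 0 <= F U)%E ->
  (\sum_(0 <= k <oo) F (nth set0 L k) <= \sum_(U <- L) F U)%E.
Proof.
move=> F0 Fge; apply: le_nneseries_partial => // N.
elim: L N => [|U L IH] N.
  by rewrite big_nil big1 // => i _; rewrite nth_nil.
case: N => [|N]; first by rewrite big_geq // sume_ge0.
by rewrite big_nat_recl //= big_cons leeD2l.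
Qed.

Lemma Eset_null (xi a b : R) : 0 < a -> 0 <= b ->
  (a - b) * xi < ln (expR a - 1) ->
  hausdorff_measure (b / ln 2) (Eset xi) = 0%E.
Proof.
move=> a0 b0 hab.
have l2 : 0 < ln (2 : R) by rewrite ln_gt0 // ltr1n.
set gap := ln (expR a - 1) - (a - b) * xi.
have gap0 : 0 < gap by rewrite subr_gt0.
(* The tolerance on the averages costs [|a - b| * e], less than half of [gap]; the + 1 covers the
   case a = b. *)
set e := gap / (2 * (`|a - b| + 1)).
have ab1 : 0 < `|a - b| + 1 by rewrite ltr_wpDl.
have e0 : 0 < e by rewrite divr_gt0 // mulr_gt0.
have he : `|a - b| * e < gap.
  rewrite /e mulrA ltr_pdivrMr ?mulr_gt0 //.
  rewrite mulrC ltr_pM2l //; have := normr_ge0 (a - b); lra.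
(* The ratio of the geometric series that dominates the costs of the successive levels. *)
set theta := expR ((a - b) * xi + `|a - b| * e - ln (expR a - 1)).
have th1 : theta < 1 by rewrite -expR0 ltr_expR; move: he; rewrite /gap; lra.
have th0 : 0 < theta by exact: expR_gt0.
have ea1 : 0 < expR a - 1 by rewrite subr_gt0 expR_gt1.
pose good (n : nat) (w : seq nat) := `|(sumn w)%:R - n%:R * xi| <= n%:R * e.
pose B (n : nat) := Num.truncn (n%:R * (xi + e)).
(* Write e^(-b S) = e^(-a S) e^((a - b) S) with S the sum of the word. For a good word the second
   factor is at most e^(n ((a - b) xi + |a - b| e)), and [sum_words] handles the first. *)
have rowcost n : \sum_(w <- words n (B n) | good n w) expR (- b * (sumn w)%:R) <= theta ^+ n.
  apply: (@le_trans _ _ (\sum_(w <- words n (B n))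
      expR (- a) ^+ sumn w * expR (n%:R * ((a - b) * xi + `|a - b| * e)))).
    rewrite big_mkcond /= ler_sum // => w _; case: ifPn => [gw|_]; last first.
      by rewrite mulr_ge0 ?exprn_ge0 ?expR_ge0.
    rewrite -expRM_natl -expRD ler_expR.
    have : (a - b) * ((sumn w)%:R - n%:R * xi) <= `|a - b| * (n%:R * e).
      by apply: le_trans (ler_norm _) _; rewrite normrM ler_wpM2l.
    by lra.
  rewrite -mulr_suml.
  have -> : theta ^+ n = (expR (- a) / (1 - expR (- a))) ^+ n *
     expR (n%:R * ((a - b) * xi + `|a - b| * e)).
    have -> : expR (- a) / (1 - expR (- a)) = expR (- ln (expR a - 1)).
      rewrite !expRN lnK ?posrE //; field.
      by rewrite !gt_eqF ?expR_gt0.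
    by rewrite -!expRM_natl -expRD; congr expR; ring.
  apply: ler_wpM2r; first exact: expR_ge0.
  by apply: sum_words; rewrite expR_ge0 /= -expR0 ltr_expR oppr_lt0.
apply: hausdorff_measure_null2 => delta eps d0 eps0.
have hN (x y : R) : 0 < x < 1 -> 0 < y -> exists N, forall n, (N <= n)%N -> x ^+ n <= y.
  move=> /andP[x0 x1] y0.
  have : `|x| < 1 by rewrite gtr0_norm.
  move=> /cvg_expr /cvgrPdist_le /(_ _ y0) [N _ hN].
  exists N => n Nn; have := hN n Nn; rewrite sub0r normrN ger0_norm //.
  by rewrite exprn_ge0 // ltW.
have [N1 hN1] : exists N, forall n, (N <= n)%N -> theta ^+ n <= eps * (1 - theta).
  by apply: hN; rewrite ?th0 ?th1 // mulr_gt0 // subr_gt0.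
have [N2 hN2] : exists N, forall n, (N <= n)%N -> (2^-1 : R) ^+ n <= delta.
  by apply: hN => //; lra.
(* [N1] makes the tail of the geometric series at most [eps], [N2] makes the diameters at most
   [delta], and the successor keeps the word lengths positive. *)
pose N0 := (maxn N1 N2).+1.
pose L n := [seq cylset w | w <- words n (B n) & good n w].
exists (fun n k => nth set0 (L (n + N0)%N) k); split.
- move=> x [hx /cvgrPdist_le /(_ _ e0) [N _ hN3]].
  pose n := (N + N0)%N.
  have n0 : (0 < n)%N by rewrite /n addn_gt0 orbT.
  have [w [sw aw sumw [y hy xy]]] := avg_digits_cyl hx n0.
  have gw : good n w.
    rewrite /good sumw -mulrBr normrM ger0_norm // ler_wpM2l // distrC.
    by apply: hN3; rewrite /= leq_addr.
  have ww : w \in words n (B n).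
    have hs : (sumn w)%:R <= n%:R * (xi + e).
      by move: gw; rewrite /good ler_norml mulrDr => /andP[_]; rewrite lerBlDl.
    by apply: mem_words => //; rewrite /B truncn_ge_nat // (le_trans _ hs).
  exists N => //.
  have : cylset w \in L n by apply/mapP; exists w => //; rewrite mem_filter gw.
  move=> /(nthP set0)[k _ kw]; exists k => //.
  by rewrite -/n kw; exists y.
- move=> n k.
  (* Beyond the end of the list the set is empty and its diameter is -oo. *)
  have [kL|kL] := ltnP k (size (L (n + N0)%N)); last first.
    by rewrite nth_default // /diam set0X image_set0 ereal_sup0 leNye.
  have /mapP[w] := mem_nth set0 kL.
  rewrite mem_filter => /andP[_ /words_size[sw aw]] ->.
  apply: diam_le => x y cx cy; apply: le_trans (diam_cylset cx cy) _.
  rewrite -exprVn; apply: hN2.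
  apply: leq_trans (leq_size_sumn aw); rewrite sw /N0.
  by rewrite (leq_trans (leq_maxr N1 N2)) // (leq_trans (leqnSn _)) // leq_addl.
- apply: (@le_trans _ _ (\sum_(0 <= n <oo) (theta ^+ (n + N0))%:E)%E).
    apply: lee_nneseries => [n _ _|n _].
      by apply: nneseries_ge0 => *; exact: hcost_ge0.
    apply: le_trans (nneseries_nth_le _ (hcost_set0 _) (hcost_ge0 _)) _.
    rewrite big_map big_filter.
    apply: (@le_trans _ _ (\sum_(w <- words (n + N0) (B (n + N0)%N) | good (n + N0)%N w)
      (expR (- b * (sumn w)%:R))%:E)%E).
      apply: lee_sum => w _.
      have s0 : 0 <= b / ln 2 by rewrite divr_ge0 // ltW.
      apply: le_trans (hcost_le s0 (@diam_cylset w)) _.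
      suff -> : (2 ^+ sumn w)^-1 `^ (b / ln 2) = expR (- b * (sumn w)%:R) by [].
      rewrite /powR gt_eqF ?invr_gt0 ?exprn_gt0 // lnV ?posrE ?exprn_gt0 // ln_pow2.
      by congr expR; field; rewrite gt_eqF.
    by rewrite sumEFin lee_fin rowcost.
  apply: le_nneseries_partial => [n|N]; first by rewrite lee_fin exprn_ge0 // ltW.
  rewrite sumEFin lee_fin.
  have -> : \sum_(0 <= i < N) theta ^+ (i + N0) =
      (theta ^+ N0 - theta ^+ (N + N0)) / (1 - theta).
    have th2 : 1 - theta != 0 by rewrite gt_eqF // subr_gt0.
    elim: N => [|N IH]; first by rewrite big_geq // subrr mul0r.
    by rewrite big_nat_recr //= IH addSn exprS; field.
  rewrite ler_pdivrMr ?subr_gt0 //; apply: (@le_trans _ _ (theta ^+ N0)).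
    by rewrite gerBl exprn_ge0 // ltW.
  by apply: hN1; rewrite /N0 (leq_trans (leq_maxl N1 N2)).
Qed.

End Upper.

(** * A Moran subset of E(xi) *)

Lemma cyl_cat (R : realType) w v (x : R) : cyl (w ++ v) x = cyl w (cyl v x).
Proof. by elim: w => [|d w IH] /=; rewrite ?cyl_cons ?IH // {2}/cyl add0r divr1. Qed.

Lemma sum_digits_cyl (R : realType) w (x : R) : all (leq 1) w -> 0 < x <= 1 ->
  \sum_(j < size w) (digit j (cyl w x))%:~R = (sumn w)%:R :> R.
Proof.
move=> aw hx; under eq_bigr => j _ do rewrite digit_cyl //.
by rewrite sumnE (big_nth 0%N) big_mkord natr_sum.
Qed.

Lemma adjacent_nat a b : (a <= b.+1)%N -> (b <= a.+1)%N ->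
  a = b.-1 \/ a = b \/ a = b.+1.
Proof. lia. Qed.

Section Moran.
Context {R : realType}.
Variables (n M : nat) (alpha : R) (blk : nat -> nat -> seq nat).
Let J (k : nat) := Num.truncn (k%:R * alpha).
Hypotheses (n0 : (0 < n)%N) (M1 : (1 < M)%N) (alpha0 : 0 < alpha).
Hypothesis blkP : forall k a, (a < M)%N ->
  [/\ size (blk k a) = (J k.+1 - J k)%N, sumn (blk k a) = n & all (leq 1) (blk k a)].
Hypothesis blk_inj : forall k a a', (a < M)%N -> (a' < M)%N ->
  blk k a = blk k a' -> a = a'.

Definition madic (k : nat) (y : R) := Num.truncn (M%:R ^+ k * y).

(** [madic k y %% M] is the k-th base-M digit of y after the point. Digits are counted from 1 and
    blocks from 0, hence the shift between [k'] and [k]. *)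
Fixpoint moran_word (k : nat) (y : R) : seq nat :=
  if k is k'.+1 then moran_word k' y ++ blk k' (madic k y %% M) else [::].

Definition moran_point (y : R) : R :=
  sup [set cyl (moran_word k y) 0 | k in [set: nat]].

Let M0 : (0 < M)%N. Proof. exact: ltnW. Qed.
Let J0 : J 0 = 0%N. Proof. by rewrite /J mul0r truncn0. Qed.
Let Jle k : (J k <= J k.+1)%N.
Proof. by rewrite /J le_truncn // ler_wpM2r ?ler_nat // ltW. Qed.

Lemma moran_wordP k y :
  [/\ size (moran_word k y) = J k, sumn (moran_word k y) = (n * k)%N &
      all (leq 1) (moran_word k y)].
Proof.
elim: k => [|k [IH1 IH2 IH3]] /=; first by rewrite J0 muln0.
have [h1 h2 h3] := blkP k (ltn_pmod (madic k.+1 y) M0).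
by rewrite size_cat sumn_cat all_cat IH1 IH2 IH3 h1 h2 h3 subnKC // mulnS addnC.
Qed.

Lemma madic_div k y : 0 <= y -> (madic k.+1 y %/ M)%N = madic k y.
Proof.
move=> y0.
have h i : 0 <= M%:R ^+ i * y by rewrite mulr_ge0 ?exprn_ge0.
have /andP[a1 a2] := truncn_itv (h k); have /andP[b1 b2] := truncn_itv (h k.+1).
rewrite -/(madic k y) in a1 a2; rewrite -/(madic k.+1 y) in b1 b2.
have Mr : (0 : R) < M%:R by rewrite ltr0n.
apply/eqP; rewrite eqn_leq -ltnS ltn_divLR // leq_divRL //; apply/andP; split.
- rewrite -(ltr_nat R); apply: le_lt_trans b1 _.
  by rewrite exprSr -mulrA mulrCA mulrC natrM ltr_pM2r // mulrC.
- rewrite -ltnS -(ltr_nat R); apply: le_lt_trans b2.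
  by rewrite exprS -mulrA natrM mulrC ler_pM2l.
Qed.

(** Prefix lengths do not depend on y, so equal words have equal blocks. [blk_inj] recovers the last
    base-M digit, and [madic_div] reduces the remaining ones to the induction hypothesis. *)
Lemma moran_word_madic k y y' : 0 <= y < 1 -> 0 <= y' < 1 ->
  moran_word k y = moran_word k y' -> madic k y = madic k y'.
Proof.
move=> hy hy'; elim: k => [_|k IH /= e].
  have h z : 0 <= z < 1 -> madic 0 z = 0%N.
    by move=> hz; apply: truncn_def; rewrite expr0 mul1r.
  by rewrite !h.
have [s1 _ _] := moran_wordP k y; have [s2 _ _] := moran_wordP k y'.
move: e => /eqP; rewrite eqseq_cat ?s1 ?s2 // => /andP[/eqP/IH e1 /eqP e2].
move: hy hy' => /andP[y0 _] /andP[y0' _].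
rewrite (divn_eq (madic k.+1 y) M) (divn_eq (madic k.+1 y') M) !madic_div // e1.
by rewrite (blk_inj _ _ e2) // ltn_pmod.
Qed.

Lemma cyl_le w : {homo @cyl R w : x y / x <= y}.
Proof. by move=> x y xy; rewrite /cyl ler_pM2r ?invr_gt0 ?exprn_gt0 // lerD2l. Qed.

(** The intervals of the prefixes are nested. Their left endpoints increase strictly, so the
    supremum is never a left endpoint and stays in every half-open interval. *)
Lemma moran_pointP k y :
  exists2 x, 0 < x <= 1 & moran_point y = cyl (moran_word k y) x.
Proof.
pose l i := cyl (moran_word i y) (0 : R); pose u i := cyl (moran_word i y) (1 : R).
have lS i : l i < l i.+1.
  have [h1 h2 h3] := blkP i (ltn_pmod (madic i.+1 y) M0).
  rewrite /l /= cyl_cat /cyl ltr_pM2r ?invr_gt0 ?exprn_gt0 // ltrD2l.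
  rewrite addr0 divr_gt0 ?exprn_gt0 // ltr0n.
  (* The block has sum n > 0, so it is nonempty and its [bval] is positive. *)
  by move: h2; case: (blk _ _) => [/=|d w _ /=]; [move: n0 => /[swap] <-|rewrite addn_gt0 expn_gt0].
have uS i : u i.+1 <= u i.
  have [h1 h2 h3] := blkP i (ltn_pmod (madic i.+1 y) M0).
  rewrite /u /= cyl_cat cyl_le //.
  have h01 : 0 < (1 : R) <= 1 by rewrite ltr01 lexx.
  by have /andP[] := cyl_itv h3 h01.
have lmono i j : (i <= j)%N -> l i <= l j.
  by move=> ij; rewrite -(subnKC ij); elim: (j - i)%N => [|d IH]; rewrite ?addn0 // addnS (le_trans IH) // ltW.
have umono i j : (i <= j)%N -> u j <= u i.
  by move=> ij; rewrite -(subnKC ij); elim: (j - i)%N => [|d IH]; rewrite ?addn0 // addnS (le_trans _ IH).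
have lu i j : l i <= u j.
  apply: le_trans (lmono i (maxn i j) _) _; first exact: leq_maxl.
  apply: le_trans (umono j (maxn i j) _); last exact: leq_maxr.
  by rewrite cyl_le // ler01.
have Sn : [set l i | i in [set: nat]] !=set0 by exists (l 0%N); exists 0%N.
have lg : l k < moran_point y.
  apply: lt_le_trans (lS k) _; apply: ub_le_sup; last by exists k.+1.
  by exists (u 0%N) => _ [i _ <-]; exact: lu.
have gu : moran_point y <= u k by apply: ge_sup => // _ [i _ <-]; exact: lu.
exists (moran_point y * 2 ^+ sumn (moran_word k y) - (bval (moran_word k y))%:R).
  have p2 : (0 : R) < 2 ^+ sumn (moran_word k y) by rewrite exprn_gt0.
  apply/andP; split.
    by move: lg; rewrite /l /cyl ltr_pdivrMr // addr0 subr_gt0.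
  by move: gu; rewrite /u /cyl ler_pdivlMr // lerBlDl.
by rewrite /cyl addrC subrK mulfK // expf_neq0 // pnatr_eq0.
Qed.

(** After [J k] digits the digit sum is exactly n k. With k the integer part of N / alpha one has
    [J k] <= N <= [J k.+1], so by monotonicity the sum of N digits differs from N n / alpha by at
    most n, and the average by at most n / N. *)
Lemma moran_point_Eset y : Eset (n%:R / alpha) (moran_point y).
Proof.
have [x hx gx] := moran_pointP 0 y.
have hg : 0 < moran_point y <= 1 by rewrite gx /= /cyl /= add0r divr1.
split => //.
pose S N : R := \sum_(j < N) (digit j (moran_point y))%:~R.
have digit_ge0 j : 0 <= (digit j (moran_point y))%:~R :> R.
  have := iter_Tmap_itv j hg; rewrite /digit; move=> /branch_exists[d [_ -> _ _]].
  by rewrite ler0n.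
have Smono i j : (i <= j)%N -> S i <= S j.
  move=> ij; rewrite -(subnKC ij); elim: (j - i)%N => [|d IH]; first by rewrite addn0.
  by rewrite addnS (le_trans IH) // /S big_ord_recr /= lerDl.
have SJ k : S (J k) = n%:R * k%:R.
  have [z hz e] := moran_pointP k y; rewrite /S e -natrM.
  by have [<- <- aw] := moran_wordP k y; rewrite sum_digits_cyl.
have bound N : `|S N - N%:R * (n%:R / alpha)| <= n%:R.
  set k := Num.truncn (N%:R / alpha).
  have Na : 0 <= N%:R / alpha by rewrite divr_ge0 // ltW.
  have /andP[] := truncn_itv Na; rewrite -/k => k1 k2.
  have J1 : (J k <= N)%N.
    rewrite /J -ltnS -(ltr_nat R); apply: (@le_lt_trans _ _ N%:R); last by rewrite ltr_nat.
    apply: (@le_trans _ _ (k%:R * alpha)); first by rewrite truncn_le mulr_ge0 // ltW.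
    by rewrite -ler_pdivlMr.
  have J2 : (N <= J k.+1)%N.
    by rewrite /J truncn_ge_nat ?mulr_ge0 ?ltW // -ltr_pdivrMr.
  have := Smono _ _ J1; have := Smono _ _ J2; rewrite !SJ => h2 h1.
  have nn : (0 : R) < n%:R by rewrite ltr0n.
  have -> : N%:R * (n%:R / alpha) = n%:R * (N%:R / alpha) by rewrite mulrCA.
  rewrite ler_norml lerBrDr lerBlDr; apply/andP; split.
    rewrite addrC lerBlDr; apply: (@le_trans _ _ (n%:R * k.+1%:R)); first by rewrite ler_pM2l // ltW.
    by rewrite -natr1 mulrDr mulr1 lerD2r.
  apply: le_trans h2 _.
  by rewrite -natr1 mulrDr mulr1 addrC lerD2l ler_pM2l.
apply/cvgrPdist_le => /= e e0.
exists (Num.truncn (n%:R / e)).+1 => // N /= hN.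
have N0 : (0 : R) < N%:R by rewrite ltr0n (leq_trans _ hN).
have -> : n%:R / alpha - avg_digits (moran_point y) N =
    - ((S N - N%:R * (n%:R / alpha)) / N%:R).
  by rewrite /avg_digits -/(S N); field; rewrite !gt_eqF.
rewrite normrN normrM [X in _ * X]gtr0_norm ?invr_gt0 // ler_pdivrMr //.
apply: le_trans (bound N) _.
have ne : 0 <= n%:R / e by rewrite divr_ge0 // ltW.
rewrite mulrC -ler_pdivrMr //; have /andP[_ h] := truncn_itv ne.
by apply: le_trans (ltW h) _; rewrite ler_nat.
Qed.

Lemma madic_itv k y : 0 <= y -> 
  (madic k y)%:R / M%:R ^+ k <= y <= (madic k y)%:R / M%:R ^+ k + (M%:R ^+ k)^-1.
Proof.
move=> y0; have p : (0 : R) < M%:R ^+ k by rewrite exprn_gt0 // ltr0n.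
have h : 0 <= M%:R ^+ k * y by rewrite mulr_ge0 // ltW.
have /andP[a1 a2] := truncn_itv h.
rewrite ler_pdivrMr // -[X in _ + X]mul1r -mulrDl ler_pdivlMr // natr1.
by rewrite ![y * _]mulrC a1 ltW.
Qed.

(** All level-k words have sum n k, so [bval] determines the word, the word determines [madic k y],
    and y is confined to one M-adic interval. *)
Lemma moran_word_cover k (c : nat) : exists V : set R,
  [/\ measurable V, (lebesgue_measure V <= ((M%:R ^+ k)^-1)%:E)%E &
      forall y, 0 <= y < 1 -> bval (moran_word k y) = c -> V y].
Proof.
have p : (0 : R) < (M%:R ^+ k)^-1 by rewrite invr_gt0 exprn_gt0 // ltr0n.
have [[y1 [hy1 c1]]|h] := pselect (exists y, 0 <= y < 1 /\ bval (moran_word k y) = c).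
- exists `[(madic k y1)%:R / M%:R ^+ k, (madic k y1)%:R / M%:R ^+ k + (M%:R ^+ k)^-1]%classic.
  split => //.
    rewrite lebesgue_measure_itv /= lte_fin ltrDl p -EFinD lee_fin; lra.
  move=> y hy cy.
  have [_ s1 w1] := moran_wordP k y; have [_ s2 w2] := moran_wordP k y1.
  have e : moran_word k y = moran_word k y1 by apply: bval_inj; rewrite ?s1 ?s2 ?cy ?c1.
  have /andP[y0 _] := hy.
  by have := madic_itv k y0; rewrite (moran_word_madic hy hy1 e) /= in_itv.
- exists set0; split => //; first by rewrite measure0 lee_fin ltW.
  by move=> y hy cy; apply: h; exists y.
Qed.

(** At scale 2^(-n k) two points of [U] have numerators differing by less than 2, because their
    offsets lie in (0, 1]. Hence only c - 1, c and c + 1 occur. The pullback of [U] is not known to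
    be measurable, so a measurable superset is produced. *)
Lemma moran_cover_scale (U : set R) k :
  (forall x y, U x -> U y -> `|x - y| <= (2 ^+ (n * k))^-1) ->
  exists V : set R, [/\ measurable V, (lebesgue_measure V <= (3 * (M%:R ^+ k)^-1)%:E)%E &
      forall y, 0 <= y < 1 -> U (moran_point y) -> V y].
Proof.
move=> hU.
have p : (0 : R) < (M%:R ^+ k)^-1 by rewrite invr_gt0 exprn_gt0 // ltr0n.
have [[y1 [hy1 U1]]|h] := pselect (exists y, 0 <= y < 1 /\ U (moran_point y)); last first.
  exists set0; split => //; first by rewrite measure0 lee_fin mulr_ge0 // ltW.
  by move=> y hy cy; apply: h; exists y.
set c := bval (moran_word k y1).
have [V1 [m1 l1 h1]] := moran_word_cover k c.-1.
have [V2 [m2 l2 h2]] := moran_word_cover k c.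
have [V3 [m3 l3 h3]] := moran_word_cover k c.+1.
exists (V1 `|` V2 `|` V3); split.
- by do 2?[apply: measurableU].
- have -> : 3 * (M%:R ^+ k)^-1 = (M%:R ^+ k)^-1 + (M%:R ^+ k)^-1 + (M%:R ^+ k)^-1 :> R by ring.
  rewrite !EFinD.
  apply: le_trans (measureU2 _ _ _) _ => //; first exact: measurableU.
  apply: leeD => //; apply: le_trans (measureU2 _ _ _) _ => //; exact: leeD.
- move=> y hy Uy; have := hU _ _ Uy U1.
  have [x hx ->] := moran_pointP k y; have [x1 hx1 ->] := moran_pointP k y1.
  have [_ s1 _] := moran_wordP k y; have [_ s2 _] := moran_wordP k y1.
  rewrite /cyl s1 s2 -mulrBl normrM [X in _ * X]gtr0_norm ?invr_gt0 ?exprn_gt0 //.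
  rewrite -[X in _ <= X]mul1r ler_pM2r ?invr_gt0 ?exprn_gt0 // => hd.
  have hlt (a b : nat) (u v : R) : 0 < u <= 1 -> 0 < v <= 1 ->
      a%:R + u - (b%:R + v) <= 1 -> (a <= b.+1)%N.
    move=> /andP[u0 u1] /andP[v0 v1] huv.
    by rewrite -ltnS -(ltr_nat R) -!natr1; lra.
  have e1 := hlt _ _ _ _ hx hx1 (le_trans (ler_norm _) hd).
  rewrite distrC in hd; have e2 := hlt _ _ _ _ hx1 hx (le_trans (ler_norm _) hd).
  rewrite -/c in e1 e2.
  have := adjacent_nat e1 e2.
  by case=> [/(h1 _ hy)|[/(h2 _ hy)|/(h3 _ hy)]] ?; [left; left|left; right|right].
Qed.

(** Equal points have equal digits, hence equal words at every level, which puts both parameters in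
    a common interval of length M^(-k) for every k. *)
Lemma moran_point_inj y y' : 0 <= y < 1 -> 0 <= y' < 1 ->
  moran_point y = moran_point y' -> y = y'.
Proof.
move=> hy hy' e.
have ew k : moran_word k y = moran_word k y'.
  have [x hx ex] := moran_pointP k y; have [x' hx' ex'] := moran_pointP k y'.
  have [s1 _ w1] := moran_wordP k y; have [s2 _ w2] := moran_wordP k y'.
  apply: (@eq_from_nth _ 0%N); rewrite s1 ?s2 // => i hi.
  have := digit_cyl w1 hx; have := digit_cyl w2 hx'.
  rewrite s1 s2 -ex -ex' e => d2 d1.
  by have := d1 _ hi; rewrite d2 // => -[].
have hk k : `|y - y'| <= (M%:R ^+ k)^-1.
  have em := moran_word_madic hy hy' (ew k).
  move: hy hy' => /andP[y0 _] /andP[y0' _].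
  have := madic_itv k y0; have := madic_itv k y0'; rewrite em.
  by move=> /andP[a1 a2] /andP[b1 b2]; rewrite ler_norml; lra.
apply/eqP; rewrite -subr_eq0 -normr_le0; apply/ler_addgt0Pr => e' e0; rewrite add0r.
have [N hN] : exists N : nat, (M%:R ^+ N)^-1 <= e'.
  exists (Num.truncn e'^-1).+1.
  rewrite -[X in _ <= X]invrK lef_pV2 ?posrE ?exprn_gt0 ?invr_gt0 ?ltr0n //.
  apply: le_trans (ltW (truncnS_gt _)) _.
  by rewrite -natrX ler_nat ltnW // ltn_expl.
exact: le_trans (hk N) hN.
Qed.

(** Mass distribution estimate: for 2^(-n (k + 1)) < r <= 2^(-n k), with r the diameter, the
    pullback has measure at most 3 M^(-k) = 3 M M^(-(k + 1)) <= 3 M 2^(-n s (k + 1)) <= 3 M r^s. *)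
Lemma moran_cover (U : set R) (s : R) : 0 <= s -> (2 ^+ n) `^ s <= M%:R ->
  (diam U <= 1%:E)%E ->
  exists V : set R, [/\ measurable V,
      (lebesgue_measure V <= (3 * M%:R)%:E * hcost s U)%E &
      forall y, 0 <= y < 1 -> U (moran_point y) -> V y].
Proof.
move=> s0 hM dU.
have Mr : (0 : R) < M%:R by rewrite ltr0n.
have C0 : (0 <= (3 * M%:R)%:E :> \bar R)%E by rewrite lee_fin mulr_ge0.
have [->|/set0P Un] := eqVneq U set0.
  by exists set0; split => //; rewrite measure0 hcost_set0 mule0.
have := diam_ge0 Un; have : U <> set0 by move=> U0; move: Un; rewrite U0 => -[].
move: (dU) (hcost_ge0 s U); rewrite /hcost.
case: asboolP => // _; case e : (diam U) => [r| |] //; rewrite !lee_fin => r1 c0 _ r0.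
have hr : forall x y, U x -> U y -> `|x - y| <= r by apply: le_diam; rewrite e.
(* A set of diameter 0 has no such scale k. It is a single point, and by injectivity it pulls back
   to at most one parameter. *)
have [rz|rn] := eqVneq r 0.
  have hV V : measurable V -> lebesgue_measure V = 0%E ->
      (lebesgue_measure V <= (3 * M%:R)%:E * (r `^ s)%:E)%E.
    by move=> _ ->; rewrite mule_ge0 // lee_fin.
  have [[y1 [hy1 U1]]|h] := pselect (exists y, 0 <= y < 1 /\ U (moran_point y)).
  + exists [set y1]; split => //; first by apply: hV => //; rewrite lebesgue_measure_set1.
    move=> y hy Uy; apply: moran_point_inj => //.
    by apply/eqP; rewrite -subr_eq0 -normr_le0 -rz; exact: hr.
  + exists set0; split => //; first by apply: hV => //; rewrite measure0.
    by move=> y hy cy; apply: h; exists y.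
have {rn}r0 : 0 < r by rewrite lt_neqAle eq_sym rn.
pose small k := (2 ^+ (n * k))^-1 < r.
have ex : exists k, small k.
  exists (Num.truncn r^-1).+1; rewrite /small.
  rewrite -[X in _ < X]invrK ltf_pV2 ?posrE ?exprn_gt0 ?invr_gt0 //.
  apply: lt_le_trans (truncnS_gt _) _.
  rewrite -natrX ler_nat; apply: leq_trans (ltnW (ltn_expl _ (ltnSn 1))) _.
  by rewrite leq_exp2l // leq_pmull.
(* The least index with 2^(-n i) < r is not 0, since r <= 1; its predecessor is the scale k. *)
case: (ex_minnP ex) => -[|k] hk hmin.
  by move: hk; rewrite /small muln0 expr0 invr1 ltNge r1.
have rk : r <= (2 ^+ (n * k))^-1.
  by rewrite leNgt; apply/negP => /hmin; rewrite ltnn.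
have [V [mV lV cV]] := @moran_cover_scale U k (fun x y Ux Uy => le_trans (hr x y Ux Uy) rk).
exists V; split => //; apply: le_trans lV _.
rewrite -EFinM lee_fin -mulrA ler_pM2l //.
rewrite -ler_pdivrMl //.
have -> : M%:R^-1 * (M%:R ^+ k)^-1 = (M%:R ^+ k.+1)^-1 :> R by rewrite exprS invfM.
apply: (@le_trans _ _ ((2 ^+ (n * k.+1))^-1 `^ s)); last first.
  by rewrite ge0_ler_powR // ?nnegrE ?invr_ge0 ?exprn_ge0 // ltW.
have -> : (2 ^+ (n * k.+1))^-1 `^ s = (((2 ^+ n) `^ s) ^+ k.+1)^-1 :> R.
  rewrite -powR_inv1 ?exprn_ge0 // powRAC powR_inv1 ?powR_ge0 //; congr _^-1.
  by rewrite exprM -powR_mulrn ?exprn_ge0 // powRAC powR_mulrn ?powR_ge0.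
rewrite lef_pV2 ?posrE ?exprn_gt0 ?powR_gt0 ?exprn_gt0 //.
by rewrite lerXn2r // nnegrE ?powR_ge0 // ltW.
Qed.

(** A cover of the set pulls back to a cover of [0, 1), so countable subadditivity of Lebesgue
    measure forces the total cost to be at least 1 / (3 M). *)
Lemma moran_measure_gt0 (s : R) : 0 <= s -> (2 ^+ n) `^ s <= M%:R ->
  hausdorff_measure s (Eset (n%:R / alpha)) <> 0%E.
Proof.
move=> s0 hM h0.
have Mr : (0 : R) < M%:R by rewrite ltr0n.
suff h : (((3 * M%:R)^-1)%:E <= hausdorff_delta s 1 (Eset (n%:R / alpha)))%E.
  have : (hausdorff_delta s 1 (Eset (n%:R / alpha)) <= 0)%E.
    by rewrite -h0; apply: ereal_sup_ubound; exists 1 => //=.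
  move=> /(le_trans h); rewrite lee_fin leNgt => /negP; apply.
  by rewrite invr_gt0 mulr_gt0.
apply: le_ereal_inf_tmp => _ [U [EU dU] <-].
have [V hV] := choice (fun i => moran_cover s0 hM (dU i)).
have mI : (lebesgue_measure (`[0%R, 1%R[%classic : set R) = 1)%E.
  by rewrite lebesgue_measure_itv /= lte_fin ltr01 oppr0 adde0.
have sub : `[0, 1[%classic `<=` \bigcup_i V i.
  move=> y; rewrite /= in_itv /= => hy.
  have [i _ Ui] := EU _ (moran_point_Eset y).
  by exists i => //; have [_ _] := hV i; apply.
have mV i : measurable (V i) by have [] := hV i.
have C0 : (0 < 3 * M%:R :> R) by rewrite mulr_gt0.
have : (1 <= (3 * M%:R)%:E * \sum_(0 <= i <oo) hcost s (U i))%E.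
  have h1 : (lebesgue_measure (`[0%R, 1%R[%classic : set R) <=
      \sum_(0 <= i <oo) lebesgue_measure (V i))%E.
    by apply: measure_sigma_subadditive.
  rewrite -mI; apply: le_trans h1 _.
  rewrite -nneseriesZl //; last by move=> i _; exact: hcost_ge0.
  apply: lee_nneseries => [i _ _|i _]; first exact: measure_ge0.
  by have [] := hV i.
have -> : (1 = (3 * M%:R)%:E * ((3 * M%:R)^-1)%:E :> \bar R)%E.
  by rewrite -EFinM mulfV ?gt_eqF.
by rewrite lee_pmul2l // lte_fin.
Qed.

End Moran.

(** * Counting compositions *)

Definition incr_head (w : seq nat) := if w is d :: w' then d.+1 :: w' else [::].

(* [compositions n m] lists the compositions of [n.+1] into [m.+1] positive parts. *)
Fixpoint compositions (n m : nat) : seq (seq nat) :=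
  match n, m with
  | 0, 0 => [:: [:: 1%N]]
  | 0, _.+1 => [::]
  | n'.+1, 0 => [:: [:: n'.+2]]
  | n'.+1, m'.+1 => map (cons 1%N) (compositions n' m') ++ map incr_head (compositions n' m)
  end.

(** A composition either starts with 1 or arises by [incr_head] from a composition of the preceding
    integer; this is Pascal's rule. *)
Lemma size_compositions n m : size (compositions n m) = 'C(n, m).
Proof.
elim: n m => [|n IH] [|m] //=.
by rewrite size_cat !size_map !IH binS addnC.
Qed.

Lemma mem_compositions n m w : w \in compositions n m ->
  [/\ size w = m.+1, sumn w = n.+1 & all (leq 1) w].
Proof.
elim: n m w => [|n IH] [|m] w //=.
- by rewrite inE => /eqP ->.
- by rewrite inE => /eqP -> /=; rewrite addn0.
rewrite mem_cat => /orP[] /mapP[v /IH[sv nv av] ->] /=.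
  by rewrite sv nv av add1n.
by case: v sv nv av => [//|d v] /= -> <- /andP[_ ->]; rewrite addSn.
Qed.

Lemma compositions_uniq n m : uniq (compositions n m).
Proof.
elim: n m => [|n IH] [|m] //=; rewrite cat_uniq; apply/and3P; split.
- by rewrite map_inj_uniq // => x y [].
- apply/hasPn => _ /mapP[v /mem_compositions[sv nv av] ->]; apply/mapP => -[u _].
  by case: v av {sv nv} => [//|d v] /= /andP[+ _] [d0]; rewrite d0.
- rewrite map_inj_in_uniq // => -[|d v] [|d' v'] //=; last by move=> _ _ [-> ->].
Qed.

(* The term of index [m] is the largest in the binomial expansion of [((n - m) + m) ^ n]. *)
Lemma expnn_le_bin n m : (m <= n)%N ->
  (n ^ n <= n.+1 * ('C(n, m) * ((n - m) ^ (n - m) * m ^ m)))%N.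
Proof.
move=> mn; pose T i := ('C(n, i) * ((n - m) ^ (n - i) * m ^ i))%N.
(* The ratio of consecutive terms is (n - i) m / ((i + 1) (n - m)), written without division through
   the common factor X. It is at least 1 for i < m and at most 1 for i >= m. *)
have E i : (i < n)%N -> let X := ('C(n, i) * ((n - m) ^ (n - i.+1) * m ^ i))%N in
    (i.+1 * T i = X * (i.+1 * (n - m)) /\ i.+1 * T i.+1 = X * ((n - i) * m))%N.
  move=> lin /=; split; rewrite /T.
    by rewrite -(subnSK lin) expnS; ring.
  by rewrite mulnA mul_bin_left expnS; ring.
have inc i : (i < m)%N -> (T i <= T i.+1)%N.
  move=> im; have lin := leq_trans im mn; have [e1 e2] := E i lin.
  rewrite -(leq_pmul2l (ltn0Sn i)) e1 e2 leq_mul2l; apply/orP; right.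
  by rewrite mulnC leq_mul // leq_sub2l // ltnW.
have dec i : (m <= i < n)%N -> (T i.+1 <= T i)%N.
  move=> /andP[im lin]; have [e1 e2] := E i lin.
  rewrite -(leq_pmul2l (ltn0Sn i)) e1 e2 leq_mul2l; apply/orP; right.
  by rewrite mulnC leq_mul // ?leq_sub2l // (leq_trans im).
have lo d : (d <= m)%N -> (T (m - d) <= T m)%N.
  elim: d => [|d IH] dm; first by rewrite subn0.
  apply: leq_trans (IH (ltnW dm)); rewrite -(subnSK dm); apply: inc.
  by rewrite ltn_subrL (leq_trans _ dm).
have hi d : (m + d <= n)%N -> (T (m + d) <= T m)%N.
  elim: d => [|d IH]; first by rewrite addn0.
  rewrite addnS => dm; apply: leq_trans (IH (ltnW dm)).
  by apply: dec; rewrite leq_addr.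
have Tm i : (i <= n)%N -> (T i <= T m)%N.
  move=> lin; have [im|mi] := leqP i m; first by rewrite -(subKn im) lo // leq_subr.
  by rewrite -(subnKC (ltnW mi)) hi // subnKC // ltnW.
have -> : (n ^ n = \sum_(i < n.+1) T i)%N by rewrite -{1}(subnK mn) expnDn.
apply: (@leq_trans (\sum_(i < n.+1) T m)%N).
  by apply: leq_sum => i _; rewrite Tm // -ltnS.
by rewrite sum_nat_const card_ord.
Qed.

(** * Entropy bounds for binomial coefficients *)

Section Entropy.
Context {R : realType}.

(** The binary entropy function with natural logarithms; the dimension of E(xi) is its value at 1 /
    xi divided by ln 2. *)
Definition entropy (q : R) : R := - (q * ln q) - (1 - q) * ln (1 - q).

Lemma expR_mulln (x : R) n : 0 < x -> expR (n%:R * ln x) = x ^+ n.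
Proof. by move=> x0; rewrite expRM_natl lnK. Qed.

(** The exponential equals n^n / (m^m (n - m)^(n - m)), so this is [expnn_le_bin] after division. *)
Lemma entropy_bin n m : (0 < m < n)%N ->
  expR (n%:R * entropy (m%:R / n%:R)) <= (n.+1 * 'C(n, m))%:R.
Proof.
move=> /andP[m0 mn].
have n0 : (0 < n)%N by apply: leq_trans mn.
have [mr nr] : 0 < m%:R :> R /\ 0 < n%:R :> R by rewrite !ltr0n.
have dr : 0 < (n - m)%:R :> R by rewrite ltr0n subn_gt0.
have P0 : 0 < (n - m)%:R ^+ (n - m) * m%:R ^+ m :> R by rewrite mulr_gt0 ?exprn_gt0.
rewrite -(ler_pM2r P0).
have -> : expR (n%:R * entropy (m%:R / n%:R)) * ((n - m)%:R ^+ (n - m) * m%:R ^+ m)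
    = n%:R ^+ n :> R.
  rewrite -!expR_mulln // -!expRD; congr expR; rewrite /entropy.
  have -> : 1 - m%:R / n%:R = (n - m)%:R / n%:R :> R.
    by rewrite natrB ?(ltnW mn) //; field; rewrite gt_eqF.
  rewrite !ln_div ?posrE //; rewrite natrB ?(ltnW mn) //; field; by rewrite gt_eqF.
rewrite -!natrX -!natrM ler_nat; apply: leq_trans (expnn_le_bin (ltnW mn)) _.
by rewrite !mulnA.
Qed.

Lemma entropy_continuous (p : R) : 0 < p < 1 -> {for p, continuous entropy}.
Proof.
move=> /andP[p0 p1].
have h (x : R) : 0 < x -> {for x, continuous (@ln R)} by exact: continuous_ln.
apply: cvgB.
  by apply: cvgN; apply: cvgM; [exact: cvg_id|exact: h].
have c1 : (1 - x : R) @[x --> p] --> 1 - p by apply: cvgB; [exact: cvg_cst|exact: cvg_id].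
apply: cvgM => //.
by apply: (@cvg_comp _ _ _ (fun x : R => 1 - x) _ _ _ _ c1); apply: h; rewrite subr_gt0.
Qed.

(** From e^x >= (x / 3)^3 with x = k n and (n + 1)^2 <= 4 n^2; the constant is 108 = 4 * 27. *)
Lemma expR_ge_sq (k : R) n : 0 < k -> (0 < n)%N -> 108 / k ^+ 3 <= n%:R ->
  (n.+1 * n.+1)%:R <= expR (k * n%:R).
Proof.
move=> k0 n0 hn.
have nr : 1 <= n%:R :> R by rewrite ler1n.
have -> : k * n%:R = 3%:R * (k * n%:R / 3) by field.
rewrite expRM_natl.
have x0 : 0 <= k * n%:R / 3 by rewrite divr_ge0 // mulr_ge0 // ltW.
apply: (@le_trans _ _ ((k * n%:R / 3) ^+ 3)); last first.
  rewrite lerXn2r ?nnegrE ?expR_ge0 //; apply: le_trans (expR_ge1Dx _); lra.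
have k3 : 0 < k ^+ 3 by rewrite exprn_gt0.
move: hn; rewrite ler_pdivrMr // => hn.
have -> : (k * n%:R / 3) ^+ 3 = n%:R ^+ 2 * (n%:R * k ^+ 3) / 27 by field.
rewrite natrM -natr1 ler_pdivlMr //.
apply: (@le_trans _ _ (n%:R ^+ 2 * 108)); last by rewrite ler_pM2l // exprn_gt0 // (lt_le_trans _ nr).
nra.
Qed.

(** Compositions of n into m parts number C(n - 1, m - 1). The slack between c and the entropy
    absorbs a factor (n + 1)^2: one n + 1 comes from [entropy_bin], the other from n C(n - 1, m - 1)
    = m C(n, m) >= C(n, m). One n must serve every m near n p. *)
Lemma bin_ge_entropy (p c : R) : 0 < p < 1 -> c < entropy p ->
  exists2 n : nat, (0 < n)%N & forall m : nat, `|m%:R - n%:R * p| <= 1 ->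
    [/\ (0 < m <= n)%N & expR (c * n%:R) <= 'C(n.-1, m.-1)%:R].
Proof.
move=> /[dup] hp /andP[p0 p1] cp.
pose c' := (c + entropy p) / 2.
have c'p : c' < entropy p by rewrite /c'; lra.
have cc' : 0 < c' - c by rewrite /c'; lra.
have : \forall q \near p, c' < entropy q.
  by have /cvgr_gt /(_ _ c'p) := entropy_continuous hp.
move=> /nbhs_ballP[d /= d0 hd].
(* The four summands give in turn n p > 1 (so m > 0), n (1 - p) > 1 (so m < n), 1 / n < d (so m / n
   is close to p), and the bound of [expR_ge_sq]. *)
pose n := (Num.truncn (p^-1 + (1 - p)^-1 + d^-1 + 108 / (c' - c) ^+ 3)).+1.
have b1 : 0 < p^-1 by rewrite invr_gt0.
have b2 : 0 < (1 - p)^-1 by rewrite invr_gt0 subr_gt0.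
have b3 : 0 < d^-1 by rewrite invr_gt0.
have b4 : 0 < 108 / (c' - c) ^+ 3 by rewrite divr_gt0 // exprn_gt0.
have hn : p^-1 + (1 - p)^-1 + d^-1 + 108 / (c' - c) ^+ 3 < n%:R by exact: truncnS_gt.
have nr : 0 < n%:R :> R by rewrite ltr0n.
have n1 : 1 < n%:R * p by rewrite -ltr_pdivrMr // div1r; lra.
have n2 : 1 < n%:R * (1 - p) by rewrite -ltr_pdivrMr ?subr_gt0 // div1r; lra.
have n3 : n%:R^-1 < d by rewrite -[d]invrK ltf_pV2 ?posrE //; lra.
have n4 : (n.+1 * n.+1)%:R <= expR ((c' - c) * n%:R) by apply: expR_ge_sq => //; lra.
exists n => // m hm.
have /andP[hm1 hm2] : -1 <= m%:R - n%:R * p <= 1 by rewrite -ler_norml.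
have m0 : (0 < m)%N by rewrite -(ltr0n R); lra.
have mn : (m < n)%N by rewrite -(ltr_nat R); lra.
rewrite m0 ltnW //; split => //.
have hq : c' < entropy (m%:R / n%:R).
  apply: hd; rewrite /ball /=; apply: le_lt_trans n3.
  have -> : p - m%:R / n%:R = - ((m%:R - n%:R * p) / n%:R) by field; rewrite gt_eqF.
  by rewrite normrN normrM [X in _ * X]gtr0_norm ?invr_gt0 // ler_pdivrMr // mulVf // gt_eqF.
have s2 : (0 : R) < (n.+1 * n.+1)%:R by rewrite ltr0n.
rewrite -(ler_pM2r s2).
apply: (@le_trans _ _ (expR (c' * n%:R))).
  have -> : c' * n%:R = c * n%:R + (c' - c) * n%:R by ring.
  by rewrite expRD ler_pM2l ?expR_gt0.
apply: (@le_trans _ _ (expR (n%:R * entropy (m%:R / n%:R)))).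
  by rewrite ler_expR mulrC ler_pM2l // ltW.
apply: le_trans (entropy_bin _) _; first by rewrite m0 mn.
rewrite -natrM ler_nat mulnC mulnA leq_mul2r; apply/orP; right.
have := mul_bin_diag n m.-1; rewrite prednK // => e.
apply: (@leq_trans (n * 'C(n.-1, m.-1))%N); last by rewrite mulnC leq_mul2l leqnSn orbT.
by rewrite e leq_pmull.
Qed.

End Entropy.

(** * Positivity of the measure below the entropy bound *)

Section Dimension.
Context {R : realType}.
Implicit Types xi : R.

Lemma Eset_measure_neq0 xi s : 1 < xi -> 0 <= s -> s * ln 2 < entropy xi^-1 ->
  0 < entropy xi^-1 -> hausdorff_measure s (Eset xi) <> 0%E.
Proof.
move=> xi1 s0 hs h0.
have l2 : 0 < ln (2 : R) by rewrite ln_gt0 // ltr1n.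
pose c := (s * ln 2 + entropy xi^-1) / 2.
have sl0 : 0 <= s * ln 2 by rewrite mulr_ge0 // ltW.
have sc : s * ln 2 < c by rewrite /c; lra.
have c0 : 0 < c by rewrite /c; lra.
have ch : c < entropy xi^-1 by rewrite /c; lra.
have xi0 : 0 < xi by apply: lt_trans xi1.
have hp : 0 < xi^-1 < 1 by rewrite invr_gt0 xi0 /= invf_lt1.
have [n n0 hn] := bin_ge_entropy hp ch.
have nr : 0 < n%:R :> R by rewrite ltr0n.
have exM : exists k : nat, expR (c * n%:R) <= k%:R.
  by exists (Num.truncn (expR (c * n%:R))).+1; exact/ltW/truncnS_gt.
(* M is the least natural number above e^(c n). Minimality bounds it by the number of compositions
   for every admissible number of parts. *)
case: (ex_minnP exM) => M hM Mmin.
have M1 : (1 < M)%N.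
  by rewrite -(ltr_nat R); apply: lt_le_trans hM; rewrite expR_gt1 mulr_gt0.
pose alpha := n%:R / xi.
have a0 : 0 < alpha by rewrite divr_gt0.
pose J (k : nat) := Num.truncn (k%:R * alpha).
(* Consecutive terms of the Beatty sequence differ from the slope by at most 1, which is the
   tolerance of [bin_ge_entropy]. *)
have hJ k : `|(J k.+1 - J k)%:R - n%:R * xi^-1| <= 1.
  have ka i : 0 <= i%:R * alpha by rewrite mulr_ge0 // ltW.
  have Jle : (J k <= J k.+1)%N by rewrite /J le_truncn // ler_wpM2r ?ler_nat // ltW.
  rewrite natrB // -/alpha.
  have := truncn_itv (ka k); have := truncn_itv (ka k.+1); rewrite -/(J k) -/(J k.+1).
  rewrite -!natr1 mulrDl mul1r => /andP[h1 h2] /andP[h3 h4]; rewrite ler_norml; lra.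
pose blk k a := nth [::] (compositions n.-1 (J k.+1 - J k).-1) a.
have Msize k : (M <= size (compositions n.-1 (J k.+1 - J k).-1))%N.
  by rewrite size_compositions; apply: Mmin; have [] := hn _ (hJ k).
have -> : xi = n%:R / alpha by rewrite /alpha invf_div mulrCA divff ?mulr1 // gt_eqF.
apply: (@moran_measure_gt0 R n M alpha blk) => //.
- move=> k a aM.
  have /mem_compositions[e1 e2 e3] := mem_nth [::] (leq_trans aM (Msize k)).
  have [/andP[m0 _] _] := hn _ (hJ k).
  by split; rewrite // ?e1 ?e2 prednK.
- move=> k a a' aM aM' /eqP.
  rewrite nth_uniq ?compositions_uniq ?(leq_trans _ (Msize k)) //; exact: eqP.
- apply: le_trans hM.
  by rewrite -powR_mulrn // powRAC powR_mulrn ?powR_ge0 // /powR gt_eqF // -expRM_natl ler_expR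
     mulrC ler_pM2r // ltW.
Qed.

End Dimension.

(** * The dimension formula and its calculus *)

Section HausdorffDim.
Context {R : realType}.
Implicit Types xi : R.

Let l2 : 0 < ln (2 : R). Proof. by rewrite ln_gt0 // ltr1n. Qed.

Lemma hdim_ge0 (E : set R) : (0 <= hdim E)%E.
Proof. by apply: le_ereal_inf_tmp => _ [s /= [s0 _] <-]; rewrite lee_fin. Qed.

Lemma hdim_le (E : set R) (c : R) : 0 <= c ->
  (forall b, c < b -> hausdorff_measure (b / ln 2) E = 0%E) -> (hdim E <= (c / ln 2)%:E)%E.
Proof.
move=> c0 h; apply/lee_addgt0Pr => e e0.
have eb : c / ln 2 + e = (c + e * ln 2) / ln 2 by rewrite mulrDl mulfK ?gt_eqF.
have e2 : 0 < e * ln 2 by rewrite mulr_gt0.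
apply: ereal_inf_lbound; exists ((c + e * ln 2) / ln 2); last by rewrite -eb.
split; last by apply: h; rewrite ltrDl.
by rewrite divr_ge0 ?(ltW l2) // addr_ge0 // ltW.
Qed.

Lemma entropy_gt0 (q : R) : 0 < q < 1 -> 0 < entropy q.
Proof.
move=> /andP[q0 q1]; rewrite /entropy.
have h1 : q * ln q < 0 by rewrite pmulr_rlt0 // ln_lt0 // q0.
have h2 : (1 - q) * ln (1 - q) < 0.
  by rewrite pmulr_rlt0 ?subr_gt0 // ln_lt0 // subr_gt0 q1 gtrBl.
lra.
Qed.

Lemma entropyV xi : 1 < xi -> entropy xi^-1 = ln (xi - 1) / xi + ln xi - ln (xi - 1).
Proof.
move=> xi1; have xi0 : 0 < xi by apply: lt_trans xi1.
rewrite /entropy; have -> : 1 - xi^-1 = (xi - 1) / xi by field; rewrite gt_eqF.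
rewrite lnV ?posrE // ln_div ?posrE ?subr_gt0 //; field; by rewrite gt_eqF.
Qed.

Lemma invr_itv01 xi : 1 < xi -> 0 < xi^-1 < 1.
Proof.
by move=> xi1; have xi0 : 0 < xi by [apply: lt_trans xi1]; rewrite invr_gt0 xi0 invf_lt1.
Qed.

Lemma hdim_Eset xi : 1 < xi -> hdim (Eset xi) = (entropy xi^-1 / ln 2)%:E.
Proof.
move=> xi1; have xi0 : 0 < xi by apply: lt_trans xi1.
have h0 := entropy_gt0 (invr_itv01 xi1).
apply/eqP; rewrite eq_le; apply/andP; split.
- apply: hdim_le => [|b hb]; first exact: ltW.
  (* For e^a = xi / (xi - 1) one has e^a - 1 = 1 / (xi - 1), and the condition of [Eset_null]
     becomes b > [entropy xi^-1]. *)
  apply: (@Eset_null R xi (ln xi - ln (xi - 1))); last first.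
  + rewrite expRB !lnK ?posrE ?subr_gt0 //.
    have -> : xi / (xi - 1) - 1 = (xi - 1)^-1 by field; rewrite gt_eqF // subr_gt0.
    rewrite lnV ?posrE ?subr_gt0 //.
    move: hb; rewrite entropyV // => hb.
    have : (ln (xi - 1) / xi + ln xi - ln (xi - 1)) * xi < b * xi by rewrite ltr_pM2r.
    have -> : (ln (xi - 1) / xi + ln xi - ln (xi - 1)) * xi =
      ln (xi - 1) + (ln xi - ln (xi - 1)) * xi by field; rewrite gt_eqF.
    by rewrite mulrBl; lra.
  + by rewrite ltW // (lt_trans h0).
  + by rewrite subr_gt0 ltr_ln ?posrE ?subr_gt0 // gtrBl.
- apply: le_ereal_inf_tmp => _ [s /= [s0 hs] <-]; rewrite lee_fin leNgt.
  apply/negP; rewrite ltr_pdivlMr // => hlt.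
  exact: (Eset_measure_neq0 xi1 s0 hlt h0 hs).
Qed.

Lemma hdim_Eset1 : hdim (Eset (1 : R)) = 0%E.
Proof.
apply/eqP; rewrite eq_le hdim_ge0 andbT.
suff : (hdim (Eset (1 : R)) <= (0 / ln 2)%:E)%E by rewrite mul0r.
apply: hdim_le => // b b0.
(* With e^a = 1 / z and xi = 1 the condition of [Eset_null] reads -b < ln (1 - z), true for small
   z. *)
have [z [z0 z1 hz]] : exists z : R, [/\ 0 < z, z < 1 & expR (- b) < 1 - z].
  have eb : expR (- b) < 1 by rewrite expR_lt1 oppr_lt0.
  have eb0 := expR_gt0 (- b).
  by exists ((1 - expR (- b)) / 2); split; lra.
apply: (@Eset_null R 1 (- ln z)); rewrite ?(ltW b0) ?oppr_gt0 ?ln_lt0 ?z0 //.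
rewrite mulr1 expRN lnK ?posrE //.
have -> : z^-1 - 1 = (1 - z) / z by field; rewrite gt_eqF.
rewrite ln_div ?posrE ?subr_gt0 //.
suff : - b < ln (1 - z) by lra.
by rewrite -ltr_expR lnK ?posrE ?subr_gt0.
Qed.

Lemma tdimE xi : 1 < xi -> tdim xi = entropy xi^-1 / ln 2.
Proof. by move=> xi1; rewrite /tdim hdim_Eset. Qed.

(** * Derivative and limits of the dimension function *)

Definition dtdim (x : R) : R := - ln (x - 1) / (x ^+ 2 * ln 2).

Lemma is_derive_ln_sub1 (x : R) : 1 < x -> is_derive x 1 (fun y : R => ln (y - 1)) (x - 1)^-1.
Proof.
move=> x1; have x0 : 0 < x - 1 by rewrite subr_gt0.
have h := is_derive1_ln x0.
have h2 : is_derive x 1 (fun y : R => y - 1) (1 - 0) by exact: is_deriveB.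
have := @is_derive1_comp R (@ln R) (fun y => y - 1) x _ _ h h2.
by rewrite subr0 mulr1.
Qed.

(** The rational terms 1 / (x (x - 1)) + 1 / x - 1 / (x - 1) cancel, leaving only the logarithm. The
    closed formula is available for y > 1 only, so it is substituted near x. *)
Lemma is_derive_tdim (x : R) : 1 < x -> is_derive x 1 (@tdim R) (dtdim x).
Proof.
move=> x1; have x0 : 0 < x by apply: lt_trans x1.
have h1 := is_derive_ln_sub1 x1; have h2 := is_derive1_ln x0.
have h3 : is_derive x 1 (fun y : R => y^-1) (- x ^- 2 *: 1).
  by apply: is_deriveV; rewrite gt_eqF.
apply: (@near_eq_is_derive _ _ _
  (fun y : R => (ln 2)^-1 *: (ln (y - 1) * y^-1 + ln y - ln (y - 1)))).
  near=> y; have y1 : 1 < y by near: y; apply: open_nbhs_nbhs; split => //; exact: open_gt.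
  by rewrite tdimE // entropyV // [RHS]mulrC.
have := is_deriveZ (ln 2)^-1 (is_deriveB (is_deriveD (is_deriveM h1 h3) h2) h1).
move/is_derive_eq; apply.
rewrite /dtdim /GRing.scale /=; field.
by rewrite !gt_eqF // subr_gt0.
Unshelve. all: by end_near. Qed.

Lemma derive1_tdim (x : R) : 1 < x -> derive1 (@tdim R) x = dtdim x.
Proof. by move=> x1; have h := is_derive_tdim x1; rewrite derive1E derive_val. Qed.

(** Apply ln y < y to y = 1 / s with s the square root of x, using x ln x = 2 s (s ln s). *)
Lemma ln_le_sqrt (x : R) : 0 < x -> - (x * ln x) <= 2 * Num.sqrt x.
Proof.
move=> x0; have s0 : 0 < Num.sqrt x by rewrite sqrtr_gt0.
rewrite -{1 2}(sqr_sqrtr (ltW x0)); set s := Num.sqrt x in s0 *.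
have := ln_sublinear (_ : 0 < s^-1); rewrite invr_gt0 s0 lnV ?posrE // => /(_ isT) h.
rewrite lnXn // -mulr_natl.
have h2 : s * (- ln s) < s * s^-1 by rewrite ltr_pM2l.
rewrite divff ?gt_eqF // in h2.
have h3 : 2 * s * (s * (- ln s)) <= 2 * s * 1 by rewrite ler_pM2l ?mulr_gt0 // ltW.
by move: h3; congr (is_true (_ <= _)); ring.
Qed.

Lemma entropy_le (q : R) : 0 < q < 1 -> entropy q <= 3 * Num.sqrt q.
Proof.
move=> /andP[q0 q1]; have := ln_le_sqrt q0.
have q2 : 0 < 1 - q by rewrite subr_gt0.
have h : - ((1 - q) * ln (1 - q)) <= q.
  have := @le_ln1Dx R ((1 - q)^-1 - 1).
  have -> : 1 + ((1 - q)^-1 - 1) = (1 - q)^-1 by ring.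
  rewrite lnV ?posrE // ltrBrDl addrN invr_gt0 => /(_ q2) h.
  have : (1 - q) * - ln (1 - q) <= (1 - q) * ((1 - q)^-1 - 1) by rewrite ler_pM2l.
  have -> : (1 - q) * ((1 - q)^-1 - 1) = q by field; rewrite gt_eqF.
  by rewrite mulrN.
have qs : q <= Num.sqrt q.
  by rewrite -{1}(sqr_sqrtr (ltW q0)) expr2 ler_piMl ?sqrtr_ge0 // -sqrtr1 ler_sqrt // ltW.
by rewrite /entropy; lra.
Qed.

Lemma entropyC (q : R) : entropy (1 - q) = entropy q.
Proof. by rewrite /entropy; have -> : 1 - (1 - q) = q by [ring]; ring. Qed.

(** The symmetry of the entropy under q -> 1 - q lets one estimate near q = 0 serve both limits: 1 /
    xi is small at infinity and 1 - 1 / xi is small at 1. *)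
Lemma tdim_small (e : R) : 0 < e -> exists2 d : R, 0 < d & forall xi, 1 < xi ->
  xi^-1 < d \/ 1 - xi^-1 < d -> `|tdim xi| < e.
Proof.
move=> e0; pose r := e * ln 2 / 3.
have r0 : 0 < r by rewrite divr_gt0 // mulr_gt0.
have key (q : R) : 0 < q < 1 -> q < r ^+ 2 -> entropy q / ln 2 < e.
  move=> hq qr; rewrite ltr_pdivrMr //; apply: le_lt_trans (entropy_le hq) _.
  have /andP[q0 _] := hq.
  have : Num.sqrt q < r by rewrite -(ltr_pXn2r (n := 2)) ?nnegrE ?sqrtr_ge0 ?(ltW r0) // sqr_sqrtr // ltW.
  by rewrite /r; lra.
exists (r ^+ 2) => [|xi xi1 h]; first by rewrite exprn_gt0.
have hq := invr_itv01 xi1.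
rewrite tdimE // ger0_norm; last by rewrite divr_ge0 ?ltW // entropy_gt0.
case: h => h; first exact: key.
rewrite -entropyC; apply: key => //.
by move: hq => /andP[q0 q1]; rewrite subr_gt0 q1 gtrBl.
Qed.

Lemma tdim_cvg1 : tdim x @[x --> (1 : R)^'+] --> (0 : R).
Proof.
apply/cvgrPdist_lt => e e0; have [d d0 hd] := tdim_small e0.
near=> x; rewrite sub0r normrN.
have x1 : 1 < x by near: x; exact: nbhs_right_gt.
have xd : x < 1 + d by near: x; apply: nbhs_right_lt; rewrite ltrDl.
apply: hd => //; right.
have x0 : 0 < x by apply: lt_trans x1.
have -> : 1 - x^-1 = (x - 1) / x by field; rewrite gt_eqF.
rewrite ltr_pdivrMr //; apply: (@lt_trans _ _ d); first by rewrite ltrBlDl.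
by rewrite ltr_pMr.
Unshelve. all: by end_near. Qed.

Lemma tdim_cvg_pinfty : tdim x @[x --> +oo] --> (0 : R).
Proof.
apply/cvgrPdist_lt => e e0; have [d d0 hd] := tdim_small e0.
near=> x; rewrite sub0r normrN.
have x1 : 1 < x by near: x; apply: nbhs_pinfty_gt; exact: num_real.
have xd : d^-1 < x by near: x; apply: nbhs_pinfty_gt; exact: num_real.
apply: hd => //; left.
have x0 : 0 < x by apply: lt_trans x1.
by rewrite -[d]invrK ltf_pV2 ?posrE ?invr_gt0.
Unshelve. all: by end_near. Qed.

Let ln2_lt2 : ln (2 : R) < 2. Proof. by apply: ln_sublinear. Qed.

Lemma dtdim_cvg1 : derive1 (@tdim R) x @[x --> (1 : R)^'+] --> +oo.
Proof.
apply/cvgryPge => A; near=> x.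
have x1 : 1 < x by near: x; exact: nbhs_right_gt.
have x2 : x < 2 by near: x; apply: nbhs_right_lt; rewrite ltr1n.
(* For 1 < x < 2 the denominator x^2 ln 2 is at most 4 * 2 = 8, so it suffices that -ln (x - 1) >= 8
   |A|. *)
have xe : x < 1 + expR (- (8 * `|A|)) by near: x; apply: nbhs_right_lt; rewrite ltrDl expR_gt0.
have x0 : 0 < x by apply: lt_trans x1.
have y0 : 0 < x - 1 by rewrite subr_gt0.
rewrite derive1_tdim // /dtdim ler_pdivlMr ?mulr_gt0 ?exprn_gt0 //.
have h : 8 * `|A| <= - ln (x - 1).
  by rewrite lerNr -ler_expR lnK ?posrE // lerBlDl ltW.
apply: le_trans h; apply: (@le_trans _ _ (`|A| * (x ^+ 2 * ln 2))).
  by rewrite ler_pM2r ?ler_norm // mulr_gt0 // exprn_gt0.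
rewrite [8 * _]mulrC ler_wpM2l //.
have -> : (8 : R) = 4 * 2 by ring.
by rewrite ler_pM ?exprn_ge0 ?(ltW x0) ?(ltW l2) ?(ltW ln2_lt2) //; nra.
Unshelve. all: by end_near. Qed.

Lemma dtdim_cvg_pinfty : derive1 (@tdim R) x @[x --> +oo] --> (0 : R).
Proof.
apply/cvgrPdist_lt => e e0; near=> x.
have x2 : 2 < x by near: x; apply: nbhs_pinfty_gt; exact: num_real.
have xe : (e * ln 2)^-1 < x by near: x; apply: nbhs_pinfty_gt; exact: num_real.
have x1 : 1 < x by apply: lt_trans x2; rewrite ltr1n.
have x0 : 0 < x by apply: lt_trans x1.
rewrite sub0r normrN derive1_tdim // /dtdim normrM normrN.
have l0 : 0 <= ln (x - 1) by apply: ln_ge0; lra.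
rewrite (ger0_norm l0) gtr0_norm ?invr_gt0 ?mulr_gt0 ?exprn_gt0 //.
rewrite ltr_pdivrMr ?mulr_gt0 ?exprn_gt0 //.
have l1 : ln (x - 1) < x by apply: lt_trans (ln_sublinear _) _; lra.
apply: lt_trans l1 _.
have -> : e * (x ^+ 2 * ln 2) = x * (x * (e * ln 2)) by ring.
by rewrite ltr_pMr // -ltr_pdivrMr ?mulr_gt0 // div1r.
Unshelve. all: by end_near. Qed.


(** * Convexity and the inflection point *)

Lemma convexity_gap (f df : R -> R) (x y l : R) : x < y -> 0 < l < 1 ->
  (forall z, x <= z <= y -> is_derive z 1 f (df z)) ->
  exists u v, [/\ x < u, u < v, v < y &
    l * f x + (1 - l) * f y - f (l * x + (1 - l) * y) =
    l * (1 - l) * (y - x) * (df v - df u)].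
Proof.
move=> xy /andP[l0 l1] hf; set z := l * x + (1 - l) * y.
have l1' : 0 < 1 - l by rewrite subr_gt0.
have yx0 : 0 < y - x by rewrite subr_gt0.
have zx : z - x = (1 - l) * (y - x) by rewrite /z; ring.
have yz : y - z = l * (y - x) by rewrite /z; ring.
have xz : x < z by rewrite -subr_gt0 zx mulr_gt0.
have zy : z < y by rewrite -subr_gt0 yz mulr_gt0.
have mvt a b : x <= a -> b <= y -> a < b ->
    exists2 c, a < c < b & f b - f a = df c * (b - a).
  move=> xa by_ ab.
  have hd c : a <= c <= b -> is_derive c 1 f (df c).
    by move=> /andP[ac cb]; apply: hf; rewrite (le_trans xa ac) (le_trans cb by_).
  have [||c] := @MVT R f df a b ab.
  - by move=> c; rewrite in_itv /= => /andP[ac cb]; apply: hd; rewrite !ltW.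
  - apply: derivable_within_continuous => c; rewrite in_itv /= => hc.
    by have := hd c hc; exact: @ex_derive.
  - by rewrite in_itv /= => hc e; exists c.
(* One mean value point on each side of z. The lengths z - x = (1 - l) (y - x) and y - z = l (y - x)
   give both slopes the same weight. *)
have [u /andP[xu uz] eu] := mvt x z (lexx _) (ltW zy) xz.
have [v /andP[zv vy] ev] := mvt z y (ltW xz) (lexx _) zy.
exists u, v; split => //; first exact: lt_trans zv.
have -> : f z = f x + df u * (z - x) by rewrite -eu addrC subrK.
have -> : f y = f x + df u * (z - x) + df v * (y - z) by rewrite -ev -eu; ring.
by rewrite zx yz; ring.
Qed.

Lemma derive_nondecreasing_convex (f df : R -> R) (a b : R) :
  (forall z, a <= z <= b -> is_derive z 1 f (df z)) ->
  (forall u v, a <= u -> u < v -> v <= b -> df u <= df v) ->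
  convex_on f [set x | a <= x <= b].
Proof.
move=> hf hdf x y l /= hx hy /andP[l0 l1].
have [->|ln0] := eqVneq l 0; first by rewrite !mul0r subr0 !mul1r !add0r.
have [->|ln1] := eqVneq l 1; first by rewrite subrr !mul0r !mul1r !addr0.
have hl : 0 < l < 1 by rewrite !lt_neqAle ln1 l1 eq_sym ln0 l0.
have main s t m : a <= s -> s < t -> t <= b -> 0 < m < 1 ->
    f (m * s + (1 - m) * t) <= m * f s + (1 - m) * f t.
  move=> as_ st tb hm.
  have [|u [v [su uv vt e]]] := @convexity_gap f df s t m st hm.
    by move=> z /andP[sz zt]; apply: hf; rewrite (le_trans as_ sz) (le_trans zt tb).
  rewrite -subr_ge0 e; have /andP[m0 m1] := hm.
  rewrite mulr_ge0 ?mulr_ge0 ?subr_ge0 ?(ltW m0) ?(ltW m1) ?(ltW st) //.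
  by apply: hdf => //; [rewrite (le_trans as_) // ltW | rewrite (le_trans _ tb) // ltW].
move: hx hy => /andP[ax xb] /andP[ay yb].
case: (ltgtP x y) => [xy|yx|->]; first exact: main.
- have := @main y x (1 - l) ay yx xb; rewrite subr_gt0 gtrBl andbC hl => /(_ isT).
  have -> : 1 - (1 - l) = l by ring.
  by rewrite addrC [X in _ <= X]addrC.
- by rewrite -!mulrDl addrC subrK !mul1r.
Qed.

(** Strict growth of the derivative makes the gap at the midpoint positive, contradicting concavity
    there. *)
Lemma derive_increasing_not_concave (f df : R -> R) (a b : R) : a < b ->
  (forall z, a <= z <= b -> is_derive z 1 f (df z)) ->
  (forall u v, a <= u -> u < v -> v <= b -> df u < df v) ->
  ~ concave_on f [set x | a <= x <= b].
Proof.
move=> ab hf hdf.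
have h2 : 0 < (2^-1 : R) < 1 by lra.
have [u [v [au uv vb e]]] := convexity_gap ab h2 hf.
move=> /(_ a b 2^-1); rewrite /= !lexx (ltW ab) /= => /(_ isT isT).
have /andP[h20 h21] := h2; rewrite (ltW h20) (ltW h21) => /(_ isT).
rewrite !mulrN -opprD lerN2 leNgt => /negP; apply.
rewrite -subr_gt0 e mulr_gt0 ?subr_gt0 ?mulr_gt0 ?subr_gt0 //.
by apply: hdf => //; exact: ltW.
Qed.

Lemma convex_onS (f : R -> R) (A B : set R) : A `<=` B -> convex_on f B -> convex_on f A.
Proof. by move=> AB h x y l Ax Ay; apply: h; exact: AB. Qed.

(** The second derivative of t times x^3 ln 2. Unlike the second derivative, it is visibly
    increasing, so its sign changes at most once. *)
Definition ddtdim (x : R) : R := 2 * ln (x - 1) - 1 - (x - 1)^-1.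

Lemma is_derive_dtdim (x : R) : 1 < x ->
  is_derive x 1 dtdim (ddtdim x / (x ^+ 3 * ln 2)).
Proof.
move=> x1; have x0 : 0 < x by apply: lt_trans x1.
have h1 := is_derive_ln_sub1 x1.
have h2 : is_derive x 1 (fun y : R => y ^+ 2 * ln 2) (2 * x * ln 2).
  have -> : (fun y : R => y ^+ 2 * ln 2) = ln 2 \*: ((@id R) ^+ 2).
    by apply/funext => y; rewrite /= mulrC.
  have := is_deriveZ (ln 2) (is_deriveX 2 (is_derive_id x 1)).
  move/is_derive_eq; apply.
  rewrite /GRing.scale /=; ring.
have n0 : x ^+ 2 * ln 2 != 0 by rewrite gt_eqF // mulr_gt0 // exprn_gt0.
have h3 : is_derive x 1 (fun y : R => (y ^+ 2 * ln 2)^-1)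
    (- (x ^+ 2 * ln 2) ^- 2 *: (2 * x * ln 2)) by exact: is_deriveV.
have := is_deriveM (is_deriveN h1) h3.
move/is_derive_eq; apply.
change (- ln (x - 1) * (- (x ^+ 2 * ln 2) ^- 2 * (2 * x * ln 2)) +
  (x ^+ 2 * ln 2)^-1 * - (x - 1)^-1 = ddtdim x / (x ^+ 3 * ln 2)).
rewrite /ddtdim; field.
by rewrite !gt_eqF // subr_gt0.
Qed.

Lemma ddtdim_incr (x y : R) : 1 < x -> x < y -> ddtdim x < ddtdim y.
Proof.
move=> x1 xy; rewrite /ddtdim.
have hx : 0 < x - 1 by rewrite subr_gt0.
have hy : 0 < y - 1 by rewrite subr_gt0 (lt_trans x1).
have h1 : ln (x - 1) < ln (y - 1) by rewrite ltr_ln ?posrE // ltrD2r.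
have h2 : (y - 1)^-1 < (x - 1)^-1 by rewrite ltf_pV2 ?posrE // ltrD2r.
by lra.
Qed.

Lemma dtdim_mvt (x y : R) : 1 < x -> x < y ->
  exists2 c, x < c < y & dtdim y - dtdim x = ddtdim c / (c ^+ 3 * ln 2) * (y - x).
Proof.
move=> x1 xy.
have hd c : x <= c -> is_derive c 1 dtdim (ddtdim c / (c ^+ 3 * ln 2)).
  by move=> xc; apply: is_derive_dtdim; exact: lt_le_trans xc.
have [||c] := @MVT R dtdim (fun c => ddtdim c / (c ^+ 3 * ln 2)) x y xy.
- by move=> c; rewrite in_itv /= => /andP[/ltW ac cb]; apply: hd.
- apply: derivable_within_continuous => c; rewrite in_itv /= => /andP[xc _].
  by have := hd c xc; exact: @ex_derive.
- by rewrite in_itv /= => hc e; exists c.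
Qed.

Lemma ddtdim_root : exists2 c : R, 1 < c & ddtdim c = 0.
Proof.
(* Chosen so that ln (b - 1) = 1, where [ddtdim] is 1 - 1/e > 0; at 2 it is -2. *)
pose b : R := 1 + expR 1.
have e1 : 1 < expR (1 : R) by rewrite expR_gt1.
have hb : 2 <= b by rewrite /b; lra.
have cont : {within `[2, b], continuous ddtdim}.
  apply: derivable_within_continuous => x; rewrite in_itv /= => /andP[x2 _].
  have x1 : 1 < x by apply: lt_le_trans x2; rewrite ltr1n.
  have x0 : x - 1 != 0 by rewrite gt_eqF // subr_gt0.
  have h1 := is_derive_ln_sub1 x1.
  have h2 : is_derive x 1 (fun y : R => y - 1) (1 - 0) by exact: is_deriveB.
  have h3 : is_derive x 1 (fun y : R => (y - 1)^-1) (- (x - 1) ^- 2 *: (1 - 0)).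
    exact: is_deriveV.
  have := is_deriveB (is_deriveB (is_deriveZ 2 h1) (is_derive_cst (1 : R) x 1)) h3.
  by exact: @ex_derive.
have g2 : ddtdim 2 < 0.
  rewrite /ddtdim; have -> : (2 : R) - 1 = 1 by ring.
  by rewrite ln1 invr1; lra.
have gb : 0 < ddtdim b.
  have b1 : b - 1 = expR 1 by rewrite /b; ring.
  rewrite /ddtdim b1 expRK.
  have : (expR (1 : R))^-1 < 1 by rewrite invf_lt1 // expR_gt0.
  lra.
have [|c hc c0] := IVT hb cont (v := 0).
  by rewrite ge_min le_max (ltW g2) (ltW gb) orbT.
exists c => //; move: hc; rewrite in_itv /= => /andP[c2 _].
by apply: lt_le_trans c2; rewrite ltr1n.
Qed.

(** With c the root of [ddtdim], t' strictly decreases on (1, c] and strictly increases on [c, oo).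
    Any other candidate has, on each side, a small interval inside one of these ranges, while an
    inflection asks for opposite convexity on its two sides. *)
Lemma tdim_inflection : exists! c : R, 1 < c /\ inflection_point (@tdim R) c.
Proof.
have [c c1 gc] := ddtdim_root.
have pos (x : R) : 1 < x -> 0 < x ^+ 3 * ln 2.
  by move=> x1; rewrite mulr_gt0 // exprn_gt0 // (lt_trans _ x1).
have inc u v : c <= u -> u < v -> dtdim u < dtdim v.
  move=> cu uv; have u1 := lt_le_trans c1 cu.
  have [w /andP[uw wv] e] := dtdim_mvt u1 uv.
  have w1 := lt_trans u1 uw.
  rewrite -subr_gt0 e mulr_gt0 ?subr_gt0 // divr_gt0 ?pos // -gc.
  by apply: ddtdim_incr => //; exact: le_lt_trans uw.
have dec u v : 1 < u -> u < v -> v <= c -> dtdim v < dtdim u.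
  move=> u1 uv vc.
  have [w /andP[uw wv] e] := dtdim_mvt u1 uv.
  have w1 := lt_trans u1 uw.
  rewrite -subr_lt0 e -oppr_gt0 -mulNr -mulNr mulr_gt0 ?subr_gt0 // divr_gt0 ?pos //.
  rewrite oppr_gt0 -gc; apply: ddtdim_incr => //; exact: lt_le_trans vc.
have hd (x : R) : 1 < x -> is_derive x 1 (@tdim R) (dtdim x) by exact: is_derive_tdim.
have hdN (x : R) : 1 < x -> is_derive x 1 (fun y => - @tdim R y) (- dtdim x).
  by move=> /hd h; exact: is_deriveN.
have noconc a b : c <= a -> a < b -> ~ concave_on (@tdim R) [set x | a <= x <= b].
  move=> ca ab; apply: (derive_increasing_not_concave ab (df := dtdim)).
    by move=> z /andP[az _]; apply: hd; exact: lt_le_trans (le_trans ca az).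
  by move=> u v au uv _; apply: inc => //; exact: le_trans au.
have noconv a b : 1 < a -> b <= c -> a < b -> ~ convex_on (@tdim R) [set x | a <= x <= b].
  move=> a1 bc ab h.
  apply: (derive_increasing_not_concave ab (f := fun y => - tdim y)
    (df := fun y => - dtdim y)).
  - by move=> z /andP[az _]; apply: hdN; exact: lt_le_trans az.
  - move=> u v au uv vb; rewrite ltrN2; apply: dec => //; first exact: lt_le_trans au.
    exact: le_trans bc.
  - by rewrite /concave_on; under eq_fun do rewrite opprK.
exists c; split; first split => //.
  exists ((c - 1) / 2); first by rewrite divr_gt0 // subr_gt0.
  right; split.
  - apply: (@derive_nondecreasing_convex _ (fun y => - dtdim y)).
      by move=> z /andP[az _]; apply: hdN; apply: lt_le_trans az; lra.
    move=> u v au uv vc; rewrite lerN2 ltW //; apply: dec => //.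
    by apply: lt_le_trans au; lra.
  - apply: (@derive_nondecreasing_convex _ dtdim).
      by move=> z /andP[az _]; apply: hd; exact: lt_le_trans az.
    by move=> u v au uv _; rewrite ltW // inc.
move=> c' [c1' [d d0 hinf]].
case: (ltgtP c c') => // cc'; exfalso.
(* The radius is cut so that c' - e >= c; both sides of c' then lie where t' strictly increases. *)
- pose e := Num.min d (c' - c).
  have e0 : 0 < e by rewrite lt_min d0 subr_gt0.
  have ed : e <= d by rewrite ge_min lexx.
  have ec : e <= c' - c by rewrite ge_min lexx orbT.
  case: hinf => -[h1 h2].
  + apply: (noconc c' (c' + e)); [exact: ltW|by rewrite ltrDl|].
    by apply: convex_onS h2 => z /= /andP[-> hz] /=; apply: le_trans hz _; rewrite lerD2l.
  + apply: (noconc (c' - e) c'); [lra|by rewrite gtrBl|].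
    by apply: convex_onS h1 => z /= /andP[hz ->]; rewrite andbT; apply: le_trans hz; lra.
(* The radius is cut so that c' + e <= c and c' - e > 1; both sides of c' then lie where t' strictly
   decreases. *)
- pose e := Num.min d (Num.min (c - c') ((c' - 1) / 2)).
  have e0 : 0 < e by rewrite !lt_min d0 subr_gt0 cc' divr_gt0 // subr_gt0.
  have ed : e <= d by rewrite ge_min lexx.
  have ec : e <= c - c' by rewrite !ge_min lexx orbT.
  have e1 : e <= (c' - 1) / 2 by rewrite !ge_min lexx !orbT.
  case: hinf => -[h1 h2].
  + apply: (noconv (c' - e) c'); [lra|exact: ltW|by rewrite gtrBl|].
    by apply: convex_onS h1 => z /= /andP[hz ->]; rewrite andbT; apply: le_trans hz; lra.
  + apply: (noconv c' (c' + e)); [by []|lra|by rewrite ltrDl|].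
    by apply: convex_onS h2 => z /= /andP[-> hz] /=; apply: le_trans hz _; rewrite lerD2l.
Qed.

End HausdorffDim.

Theorem theorem1p1 (R : realType) :
  hdim (Eset (1 : R)) = 0%E /\
  (forall xi : R, 1 < xi ->
     hdim (Eset xi) = ((ln (xi - 1) / xi + ln xi - ln (xi - 1)) / ln 2)%:E) /\
  tdim (2 : R) = 1 /\
  (tdim x @[x --> (1 : R)^'+] --> 0) /\
  (tdim x @[x --> +oo] --> (0 : R)) /\
  (forall xi : R, 1 < xi -> derivable (@tdim R) xi 1) /\
  (forall xi : R, 1 < xi < 2 -> 0 < derive1 (@tdim R) xi) /\
  derive1 (@tdim R) 2 = 0 /\
  (forall xi : R, 2 < xi -> derive1 (@tdim R) xi < 0) /\
  (derive1 (@tdim R) x @[x --> (1 : R)^'+] --> +oo) /\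
  (derive1 (@tdim R) x @[x --> +oo] --> (0 : R)) /\
  (exists! c : R, 1 < c /\ inflection_point (@tdim R) c).
Proof.
have l2 : 0 < ln (2 : R) by rewrite ln_gt0 // ltr1n.
have two1 : 1 < (2 : R) by rewrite ltr1n.
have sub21 : (2 : R) - 1 = 1 by ring.
have den (x : R) : 1 < x -> 0 < x ^+ 2 * ln 2.
  by move=> x1; rewrite mulr_gt0 // exprn_gt0 // (lt_trans _ x1).
split; first exact: hdim_Eset1.
split; first by move=> xi xi1; rewrite hdim_Eset // entropyV.
split; first by rewrite tdimE // entropyV // sub21 ln1 mul0r add0r subr0 divff // gt_eqF.
split; first exact: tdim_cvg1.
split; first exact: tdim_cvg_pinfty.
split; first by move=> xi /is_derive_tdim h; exact: ex_derive.
split.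
  move=> xi /andP[xi1 xi2]; rewrite derive1_tdim // /dtdim divr_gt0 ?den //.
  by rewrite oppr_gt0 ln_lt0 // subr_gt0 xi1 ltrBlDr.
split; first by rewrite derive1_tdim // /dtdim sub21 ln1 oppr0 mul0r.
split.
  move=> xi xi2; have xi1 := lt_trans two1 xi2.
  rewrite derive1_tdim // /dtdim mulNr oppr_lt0 divr_gt0 ?den // ln_gt0 //.
  by rewrite ltrBrDr.
split; first exact: dtdim_cvg1.
split; first exact: dtdim_cvg_pinfty.
exact: tdim_inflection.
Qed.
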